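(* Let $K$ be a number field with ring of integers $\mathcal{O}_K$ and let $\mathfrak{B}=\{\mathfrak{b}_\ell:\ell\ge1\}$ be an Erdős family of ideals in $\mathcal{O}_K$. Let $D=\prod_{\ell\ge1}(1-1/N(\mathfrak{b}_\ell))$. For every $S$-invariant Borel probability measure $\nu$ on $X_{\mathfrak{B}}$ with $\nu(Y)=1$ and $\theta_*\nu=P$ one has $h_\nu(S\mid\mathscr{F}_\theta)\le D$, and equality holds if and only if $\nu=\kappa$.
   Context: $\mathbf{Erdős\ family.}$ For a nonzero ideal $\mathfrak{b}\subseteq\mathcal{O}_K$ put $N(\mathfrak{b})=|\mathcal{O}_K/\mathfrak{b}|$. A family $\mathfrak{B}=\{\mathfrak{b}_\ell:\ell\ge1\}$ of proper nonzero ideals is Erdős if it is infinite, pairwise coprime ($\mathfrak{b}_\ell+\mathfrak{b}_m=\mathcal{O}_K$ for $\ell\neq m$), and $\sum_\ell1/N(\mathfrak{b}_\ell)<\infty$. $\mathbf{Subshift.}$ $\mathcal{O}_K\cong\mathbb{Z}^d$ acts on $\{0,1\}^{\mathcal{O}_K}$ (product topology) by $(S_ax)(b)=x(a+b)$; $S=(S_a)_{a\in\mathcal{O}_K}$, $\operatorname{supp}x=\{a:x_a=1\}$. For $A\subseteq\mathcal{O}_K$, $|A/\mathfrak{b}|$ is the number of residue classes mod $\mathfrak{b}$ met by $A$. $X_{\mathfrak{B}}$ is the set of $x\in\{0,1\}^{\mathcal{O}_K}$ with $|\operatorname{supp}x/\mathfrak{b}_\ell|<N(\mathfrak{b}_\ell)$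 for every $\ell$; it is closed and shift-invariant. $Y\subseteq X_{\mathfrak{B}}$ is the set of $x$ with $|\operatorname{supp}x/\mathfrak{b}_\ell|=N(\mathfrak{b}_\ell)-1$ for every $\ell$. $\mathbf{Phases.}$ $G=\prod_{\ell\ge1}\mathcal{O}_K/\mathfrak{b}_\ell$ with Haar probability measure $P$ and Borel $\sigma$-algebra $\mathscr{B}_G$. For $x\in Y$ let $r_\ell(x)\in\mathcal{O}_K/\mathfrak{b}_\ell$ be the unique class with $\operatorname{supp}x\cap(r_\ell(x)+\mathfrak{b}_\ell)=\varnothing$, and define the phase map $\theta:Y\to G$, $\theta(x)=(-r_\ell(x))_{\ell\ge1}$. Put $\mathscr{F}_\theta=\theta^{-1}(\mathscr{B}_G)$, an $S$-invariant $\sigma$-algebra (considered modulo null sets for measures with $\nu(Y)=1$). Define $\varphi:G\to\{0,1\}^{\mathcal{O}_K}$ by $\varphi(g)(a)=1$ iff $g_\ell+a\neq0$ in $\mathcal{O}_K/\mathfrak{b}_\ell$ for every $\ell$. Let $\beta$ be the uniform Bernoulli (fair coin) measure on $\{0,1\}^{\mathcal{O}_K}$, $\Phi(g,\omega)=\varphi(g)\cdot\omega$ (coordinatewise product), and $\kappa=\Phi_*(P\otimes\beta)$, a measure on $X_{\mathfrak{B}}$. $\mathbf{Relative\ entropy.}$ Logarithms are base 2. For a finite Borel partition $\mathcal{Q}$ and a $\sigma$-algebra $\mathscr{F}$, $H_\nu(\mathcal{Q}\mid\mathscr{F})=\int\sum_{Q\in\mathcal{Q}}-\nu(Q\mid\mathscr{F})\log_2\nu(Q\mid\mathscr{F})\,d\nu$.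 With $(F_n)$ a fixed tempered Følner sequence in $\mathcal{O}_K$ and $\mathscr{F}$ an $S$-invariant $\sigma$-algebra, $h_\nu(S,\mathcal{Q}\mid\mathscr{F})=\lim_n\frac1{|F_n|}H_\nu(\bigvee_{a\in F_n}S_a^{-1}\mathcal{Q}\mid\mathscr{F})$ and $h_\nu(S\mid\mathscr{F})=\sup_{\mathcal{Q}}h_\nu(S,\mathcal{Q}\mid\mathscr{F})$ over all finite Borel partitions $\mathcal{Q}$. *)

(* Defs.v *)
From HB Require Import structures.
From mathcomp Require Import all_boot all_order all_algebra all_field finmap.
From mathcomp Require Import all_classical all_reals all_analysis.

Set Implicit Arguments.
Unset Strict Implicit.
Unset Printing Implicit Defensive.

Import Order.TTheory GRing.Theory Num.Theory.
Import numFieldNormedType.Exports.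

Local Open Scope classical_set_scope.
Local Open Scope quotient_scope.
Local Open Scope ring_scope.

Notation borel T := (g_sigma_algebraType (@open T)).

Section RingOfIntegers.
Variable K : fieldExtType rat.

Definition integers : {pred K} :=
  fun x => `[< integralOver (intr : int -> K) x >].

Lemma integers_subring : subring_closed integers.
Proof.
split.
- by apply/asboolP; exact: (@integral1 int K intr).
- move=> x y /asboolP ix /asboolP iy; apply/asboolP.
  exact: (@integral_sub int K intr).
- move=> x y /asboolP ix /asboolP iy; apply/asboolP.
  exact: (@integral_mul int K intr).
Qed.

HB.instance Definition _ :=
  GRing.isSubringClosed.Build K integers integers_subring.

Definition OK : Type := {x : K | integers x}.
HB.instance Definition _ := Choice.on OK.
HB.instance Definition _ := SubType.on OK.
HB.instance Definition _ := [SubChoice_isSubComNzRing of OK by <:].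

End RingOfIntegers.

HB.instance Definition _ (V : zmodType) (I : zmodClosed V) :=
  isPointed.Build (Quotient.quot I) 0.

Section Ideals.
Variable K : fieldExtType rat.
Implicit Type I : idealr (OK K).

(* [fset_set] sends an infinite set to [fset0]; all sets of residues modulo a
   nonzero ideal of [OK K] are finite. *)
Definition ideal_norm I : nat := #|` fset_set [set: {ideal_quot I}] |.

Definition num_residues (A : set (OK K)) I : nat :=
  #|` fset_set [set \pi_{ideal_quot I} a | a in A] |.

(* Ideals of type [idealr] are proper by definition. The index set
   {1, 2, ...} of the family is replaced by [nat]. *)
Definition erdos_family (R : realType) (b : nat -> idealr (OK K)) : Prop :=
  [/\ forall l, exists2 x, x \in b l & x != 0,
      infinite_set (range (fun l => [set` b l])),
      forall l m, l != m ->
        [set x + y | x in [set` b l] & y in [set` b m]] = [set: OK K]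
    & cvgn (series (fun l => ((ideal_norm (b l))%:R^-1 : R)))].

End Ideals.

Section Folner.
Variables (V : zmodType) (R : realType).
Local Open Scope fset_scope.

Definition folner (F : nat -> {fset V}) : Prop :=
  (forall n, F n != fset0) /\
  forall a : V,
    let aF n := [fset (a + x)%R | x in F n] in
    (#|` (aF n `\` F n) `|` (F n `\` aF n)|%:R / #|` F n|%:R : R)%R
      @[n --> \oo] --> (0 : R)%R.

Definition tempered (F : nat -> {fset V}) : Prop :=
  exists C : nat, forall n,
    (#|` \big[@fsetU V/fset0]_(k < n) [fset (y - x)%R | x in F k, y in F n]|
       <= C * #|` F n|)%N.

End Folner.

Section RelativeEntropy.
Context {d : measure_display} {T : measurableType d} {R : realType}.
Implicit Types (nu : probability T R) (F : set (set T)).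

Definition log2 (x : R) : R := ln x / ln 2.

Definition is_cond_prob nu F (A : set T) (f : T -> R) : Prop :=
  [/\ measurable_fun [set: g_sigma_algebraType F] f,
      nu.-integrable setT (EFin \o f)
    & forall B, F B -> (\int[nu]_(x in B) (f x)%:E)%E = nu (A `&` B)].

(* A version of the conditional probability nu(A | F), unique up to nu-null
   sets; it exists for every measurable A and every sub-sigma-algebra F. *)
Definition cond_prob nu F (A : set T) : T -> R :=
  xget (fun=> 0) [set f | is_cond_prob nu F A f].

Definition cond_entropy nu F (I : finType) (Q : I -> set T) : \bar R :=
  (\int[nu]_x
     (\sum_(i : I) - (cond_prob nu F (Q i) x * log2 (cond_prob nu F (Q i) x)))
       %:E)%E.

Variables (V : choiceType) (S : V -> T -> T).

(* The join of the partitions S_a^-1 Q for a in E: the cells are indexed by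
   the names c : E -> I, and may be empty. *)
Definition join_partition (E : {fset V}) (I : finType) (Q : I -> set T) :
    {ffun E -> I} -> set T :=
  fun c => [set x | forall a : E, Q (c a) (S (val a) x)].

Definition entropy_partition nu (E : nat -> {fset V}) F
    (I : finType) (Q : I -> set T) : \bar R :=
  limn (fun n => ((#|` E n|%:R^-1)%:E *
                  cond_entropy nu F (@join_partition (E n) I Q))%E).

Definition relative_entropy nu (E : nat -> {fset V}) F : \bar R :=
  ereal_sup [set h | exists k (Q : 'I_k -> set T),
    [/\ partition setT Q setT, forall i, measurable (Q i)
      & h = entropy_partition nu E F Q]].

End RelativeEntropy.

Section Subshift.
Variable K : fieldExtType rat.

Definition config : Type := {ptws OK K -> bool}.
HB.instance Definition _ := Pointed.on config.
HB.instance Definition _ := Topological.on config.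

Definition shift_map (a : OK K) (x : borel config) : borel config :=
  fun c => x (a + c).

Definition supp (x : borel config) : set (OK K) := [set a | x a].

Definition shift_invariant (R : realType)
    (nu : probability (borel config) R) : Prop :=
  forall a A, measurable A -> nu (shift_map a @^-1` A) = nu A.

Definition fair_coin (R : realType)
    (beta : probability (borel config) R) : Prop :=
  forall (E : {fset OK K}) (w : OK K -> bool),
    beta [set x | forall a, a \in E -> x a = w a]
      = ((2 : R)^-1 ^+ #|` E|)%:E.

Variable b : nat -> idealr (OK K).

Definition XB : set (borel config) :=
  [set x | forall l, (num_residues (supp x) (b l) < ideal_norm (b l))%N].

Definition Y : set (borel config) :=
  [set x | XB x /\
    forall l, num_residues (supp x) (b l) = (ideal_norm (b l) - 1)%N].

Definition phase_group : Type :=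
  prod_topology (fun l => discrete_topology {ideal_quot (b l)}).
HB.instance Definition _ := Pointed.on phase_group.
HB.instance Definition _ := Topological.on phase_group.

Definition phase_add (g h : borel phase_group) : borel phase_group :=
  fun l => (g l : {ideal_quot (b l)}) + (h l : {ideal_quot (b l)}).

(* Haar measure on a compact group is the translation-invariant Borel
   probability measure. *)
Definition is_haar (R : realType)
    (P : probability (borel phase_group) R) : Prop :=
  forall g A, measurable A -> P (phase_add g @` A) = P A.

Definition missing_class (x : borel config) (l : nat) : {ideal_quot (b l)} :=
  xget 0 [set r | forall a, \pi_{ideal_quot (b l)} a = r -> ~ supp x a].

(* The phase map is extended by 0 outside Y, so that the sigma-algebra it
   generates lives on the full shift; this only matters on a set that is
   null for every nu with nu(Y) = 1. *)
Definition theta (x : borel config) : borel phase_group :=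
  fun l => if x \in Y then - missing_class x l else 0.

Definition F_theta : set (set (borel config)) := g_sigma_algebra_preimage theta.

Definition varphi (g : borel phase_group) : borel config :=
  fun a => `[< forall l,
    (g l : {ideal_quot (b l)}) + \pi_{ideal_quot (b l)} a != 0 >].

Definition Phi (gw : borel phase_group * borel config) : borel config :=
  fun a => varphi gw.1 a && gw.2 a.

Definition kappa (R : realType) (P : probability (borel phase_group) R)
    (beta : probability (borel config) R) : set (borel config) -> \bar R :=
  pushforward (P \x beta)%E Phi.

Definition density (R : realType) : R :=
  limn (fun n => \prod_(l < n) (1 - (ideal_norm (b l))%:R^-1 : R)).

End Subshift.

(* Main.v *)
Require Import Defs.
From HB Require Import structures.
From mathcomp Require Import all_boot all_order all_algebra all_field finmap.
From mathcomp Require Import all_classical all_reals all_analysis.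
From mathcomp Require Import measurable_realfun zify ring lra.

(* Idea.  On Y one has x <= varphi (theta x), so given the phase g a window A of
   x can be described by one bit per site of A allowed by g; the mean number of
   such bits is D #|A|.  By Gibbs' inequality the mean length of any code whose
   weights depend measurably on the phase bounds the conditional entropy from
   above, so everything reduces to exhibiting codes.  A general partition is
   compared with windows of x through a finite-window approximation, whose errors
   cost little.  If nu differs from kappa, then the events "x contains E" (a
   pi-system) detect it for some finite E; tilting the fair-coin weight slightly
   on a positive proportion of disjoint translates t + E saves a positive number
   of bits per site, hence h < D.  For nu = kappa the conditional law of a window
   given the phase is the fair-coin weight itself, and the partition according to
   x_0 has entropy exactly D. *)

Import Order.TTheory GRing.Theory Num.Theory.
Import numFieldNormedType.Exports.
Local Open Scope classical_set_scope.
Local Open Scope ring_scope.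

Set Implicit Arguments.
Unset Strict Implicit.
Unset Printing Implicit Defensive.

(** * Conditional probabilities and entropy *)

(** A strict inequality for each partition would not survive the supremum over partitions, so the
    gain has to be uniform: it depends only on [E] and [eta], not on the partition or on the window.
    For that reason the tilt acts on the window of [x], and the names of an arbitrary partition are
    coded through a mixture over all possible windows, which is at least its term at the true
    window. Per translate, tilting by [eta] changes the mean length by [- eta * bias] to first
    order, with a second-order error of at most [2 * eta ^+ 2] (both over [ln 2]). Shift invariance
    of [nu] and translation invariance of Haar measure give every translate the same mean, and a
    greedy packing bounds their number below by the size of the Folner set over a constant of [E].
    The codes read the phase only through the finite word [restr A (phi x)], so the tower property
    for finite-valued maps suffices. *)

Section SubSigmaAlgebra.
Context {d : measure_display} {T : measurableType d} {R : realType}.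

Lemma measurable_subsigma (F : set (set T)) A : sigma_algebra setT F ->
  measurable (A : set (g_sigma_algebraType F)) <-> F A.
Proof.
move=> sF; rewrite /measurable /=; split => [|FA]; last exact: sub_sigma_algebra.
by rewrite sigma_algebra_id.
Qed.

Variables (mu : {finite_measure set T -> \bar R}) (F : set (set T)).

(** The value is [mu] itself; carrying [sF] and [mF] in the term lets the measure structure on the
    coarser space be inferred from it. *)
Definition subsigma_measure (sF : sigma_algebra setT F)
    (mF : F `<=` measurable) : set (g_sigma_algebraType F) -> \bar R := mu.

Variables (sF : sigma_algebra setT F) (mF : F `<=` measurable).
Local Notation mu' := (subsigma_measure sF mF).

Let mu'_semi_sigma_additive : semi_sigma_additive mu'.
Proof.
have mTF B : measurable (B : set (g_sigma_algebraType F)) -> measurable (B : set T).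
  by move=> /(measurable_subsigma _ sF) /mF.
move=> G mG tG mUG; apply: (@measure_semi_sigma_additive _ T R mu) => //.
- by move=> i; exact: mTF.
- exact: mTF.
Qed.

HB.instance Definition _ := isMeasure.Build _ (g_sigma_algebraType F) R mu'
  (measure0 mu) (@measure_ge0 _ _ _ mu) mu'_semi_sigma_additive.

Let mu'_fin_num_fun : fin_num_fun mu'.
Proof. by move=> B /(measurable_subsigma _ sF) /mF mB; exact: fin_num_measure. Qed.

HB.instance Definition _ :=
  Measure_isFinite.Build _ (g_sigma_algebraType F) R mu' mu'_fin_num_fun.

End SubSigmaAlgebra.

Section ConditionalProbability.
Context {d : measure_display} {T : measurableType d} {R : realType}.
Variables (nu : probability T R) (F : set (set T)).
Hypotheses (sF : sigma_algebra setT F) (mF : F `<=` measurable).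

Lemma measurable_fun_subsigma (f : T -> R) :
  measurable_fun [set: g_sigma_algebraType F] f -> measurable_fun setT f.
Proof.
move=> mf _ B mB; apply: mF; apply/(measurable_subsigma _ sF).
exact: (mf measurableT B mB).
Qed.

(** The set where [g < f] belongs to [F], so the hypothesis may be tested on it; there [f - g] is
    positive with integral at most 0, hence the set is null. *)
Lemma ae_le_subsigma (f g : T -> R) :
  measurable_fun [set: g_sigma_algebraType F] f ->
  measurable_fun [set: g_sigma_algebraType F] g ->
  nu.-integrable setT (EFin \o f) -> nu.-integrable setT (EFin \o g) ->
  (forall B, F B ->
    (\int[nu]_(x in B) (f x)%:E <= \int[nu]_(x in B) (g x)%:E)%E) ->
  {ae nu, forall x, f x <= g x}.
Proof.
move=> mf mg intf intg fg; pose B := [set x | g x < f x].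
have FB : F B.
  apply/(measurable_subsigma _ sF).
  rewrite (_ : B = [set: T] `&` ((f \- g) @^-1` `]0, +oo[)); last first.
    by rewrite setTI; apply/seteqP; split => x /=; rewrite in_itv/= subr_gt0 andbT.
  exact: (@measurable_funB _ (g_sigma_algebraType F) R _ f g mf mg).
have mB := mF FB.
have intB h : nu.-integrable setT (EFin \o h) -> nu.-integrable B (EFin \o h).
  by move=> ih; apply: integrableS ih.
have le0 : (\int[nu]_(x in B) ((f x)%:E - (g x)%:E) <= 0)%E.
  rewrite integralB//; [|exact: intB|exact: intB].
  rewrite leeBlDr ?add0e; first exact: fg.
  by apply: integrable_fin_num => //; exact: intB.
have eq0 : (\int[nu]_(x in B) `|(f x)%:E - (g x)%:E|)%E = 0%E.
  apply/eqP; rewrite eq_le integral_ge0// andbT.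
  apply: le_trans le0; rewrite le_eqVlt; apply/orP; left; apply/eqP.
  apply: eq_integral => x /set_mem Bx; rewrite gee0_abs//.
  by rewrite -EFinB lee_fin subr_ge0 ltW.
have /ae_eq_integral_abs : measurable_fun B (fun x => (f x)%:E - (g x)%:E)%E.
  apply: (measurable_funS measurableT) => //.
  apply: emeasurable_funB; apply/measurable_EFinP; exact: measurable_fun_subsigma.
move=> /(_ nu mB)[/(_ eq0) + _]; apply: filterS => x /= fgx.
rewrite leNgt; apply/negP => Bx; have := fgx Bx.
by case => /eqP; rewrite subr_eq0 => /eqP e; move: Bx; rewrite /B/= e ltxx.
Qed.

Lemma is_cond_prob_unique A f g :
  is_cond_prob nu F A f -> is_cond_prob nu F A g ->
  {ae nu, forall x, f x = g x}.
Proof.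
move=> [mf intf fA] [mg intg gA].
have H1 : {ae nu, forall x, f x <= g x}.
  by apply: ae_le_subsigma => // B FB; rewrite fA// gA.
have H2 : {ae nu, forall x, g x <= f x}.
  by apply: ae_le_subsigma => // B FB; rewrite fA// gA.
by apply: filterS2 H1 H2 => x fg gf; apply/eqP; rewrite eq_le fg gf.
Qed.

(** The Radon-Nikodym derivative, on the coarser space, of [nu] restricted to [A] with respect to
    [nu]. *)
Lemma is_cond_prob_exists A : measurable A -> exists f, is_cond_prob nu F A f.
Proof.
move=> mA; pose TF := g_sigma_algebraType F.
pose mu1 : {finite_measure set TF -> \bar R} := subsigma_measure nu sF mF.
pose mu2 : {finite_measure set TF -> \bar R} := subsigma_measure (mrestr nu mA) sF mF.
have m21 : mu2 `<< mu1.
  apply/null_content_dominatesP => B /(measurable_subsigma _ sF) /mF mB m1B.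
  apply/eqP; rewrite eq_le measure_ge0 andbT -m1B.
  by apply: le_measure; rewrite ?inE//; exact: measurableI.
pose RN := @Radon_Nikodym _ TF R (@charge_of_finite_measure _ TF R mu2) mu1.
have RNfin x : RN x \is a fin_num by apply: Radon_Nikodym_fin_num; exact: m21.
have RNint : mu1.-integrable setT RN by apply: Radon_Nikodym_integrable; exact: m21.
have RNE : RN = EFin \o (fine \o RN).
  by apply/funext => x /=; rewrite fineK.
have mRN := measurable_int _ RNint.
have mRN' : measurable_fun [set: T] RN.
  rewrite RNE; apply/measurable_EFinP; apply: measurable_fun_subsigma.
  by apply/measurable_EFinP; rewrite -RNE.
(* The measure on the coarser space is the pushforward of [nu] along the identity, which converts
   integrals between the two spaces. *)
have mid : measurable_fun [set: T] (idfun : T -> TF).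
  by move=> _ B /(measurable_subsigma _ sF)/mF; rewrite setTI.
have iRN : nu.-integrable setT RN.
  apply/integrableP; split => //; move/integrableP : RNint => [_].
  rewrite -[X in (X < _)%E -> _]/(\int[pushforward nu (idfun : T -> TF)]_x `|RN x|)%E.
  rewrite ge0_integral_pushforward//.
  exact: measurableT_comp.
exists (fine \o RN); split.
- by apply/measurable_EFinP; rewrite -RNE.
- by rewrite -RNE.
- move=> B FB; have mB : measurable (B : set TF) by exact/(measurable_subsigma _ sF).
  transitivity (\int[mu1]_(x in B) RN x)%E.
    rewrite -[RHS]/(\int[pushforward nu (idfun : T -> TF)]_(x in B) RN x)%E.
    rewrite integral_pushforward//=; last first.
    + apply: (@integrableS _ _ _ nu setT) => //; first exact: mF.
    + by apply: eq_integral => x _; rewrite /= fineK.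
  by rewrite -Radon_Nikodym_integral// /mu2/= /subsigma_measure /mrestr setIC.
Qed.

Lemma cond_probP A : measurable A -> is_cond_prob nu F A (cond_prob nu F A).
Proof.
move=> mA; have [f fA] := is_cond_prob_exists mA.
by rewrite /cond_prob; case: xgetP => [g _//|/(_ f)].
Qed.

(** Clamping any version into [0, 1] changes it on a null set only. Bounds that hold everywhere make
    the later integrands bounded, hence integrable. *)
Lemma is_cond_prob_01 A : measurable A ->
  exists p : T -> R, is_cond_prob nu F A p /\ forall x, 0 <= p x <= 1.
Proof.
move=> mA; have [f [mf intf fA]] := is_cond_prob_exists mA.
have mf' := measurable_fun_subsigma mf.
have ge0 : {ae nu, forall x, 0 <= f x}.
  apply: ae_le_subsigma => //.
  - by apply: (finite_measure_integrable_cst nu 0 measurableT).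
  - by move=> B FB; rewrite fA// integral0; exact: measure_ge0.
have le1 : {ae nu, forall x, f x <= 1}.
  apply: ae_le_subsigma => //.
  - by apply: (finite_measure_integrable_cst nu 1 measurableT).
  - move=> B FB; rewrite fA// integral_cst; last exact: mF.
    rewrite mul1e; apply: le_measure; rewrite ?inE.
    + by apply: measurableI => //; exact: mF.
    + exact: mF.
    + exact: subIsetr.
pose p x := Num.min 1 (Num.max 0 (f x)).
have fp : {ae nu, forall x, f x = p x}.
  apply: filterS2 ge0 le1 => x f0 f1.
  by rewrite /p (max_idPr f0) (min_idPr f1).
have mp : measurable_fun [set: g_sigma_algebraType F] p.
  by apply: measurable_minr => //; apply: measurable_maxr.
have mp' := measurable_fun_subsigma mp.
have p01 x : 0 <= p x <= 1 by rewrite /p le_min ler01 le_max lexx/= ge_min lexx.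
exists p; split=> //; split=> //.
- apply: (@measurable_bounded_integrable _ _ _ nu) => //.
    by rewrite ltey_eq fin_num_measure.
  exists 1; split; first exact: num_real.
  move=> M M1 x _; have /andP[p0 p1] := p01 x.
  by rewrite /= ger0_norm// (le_trans p1)// ltW.
- move=> B FB; rewrite -fA//; apply: ae_eq_integral.
  + exact: mF.
  + by apply: measurable_funTS; apply/measurable_EFinP.
  + by apply: measurable_funTS; apply/measurable_EFinP.
  + by apply: filterS fp => x /= ->.
Qed.

End ConditionalProbability.

Section FiniteValued.
Context {d : measure_display} {T : measurableType d} {R : realType}.
Variable (nu : probability T R).

Lemma measurable_fun_fintype (I : finType) (r : T -> I) (f : I -> R) :
  (forall i, measurable (r @^-1` [set i])) -> measurable_fun setT (f \o r).
Proof.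
move=> mr _ B mB; rewrite setTI.
rewrite (_ : _ @^-1` _ = \bigcup_(i in [set i | B (f i)]) r @^-1` [set i]).
  by apply: fin_bigcup_measurable => // i _; exact: mr.
by apply/seteqP; split => [x /= Bx|x [i /= Bi ->]//]; exists (r x).
Qed.

Lemma bounded_integrable (f : T -> R) (M : R) : measurable_fun setT f ->
  (forall x, `|f x| <= M) -> nu.-integrable setT (EFin \o f).
Proof.
move=> mf fM; apply: measurable_bounded_integrable => //.
- by rewrite ltey_eq fin_num_measure.
- by exists M; split; [exact: num_real|move=> N MN x _; exact: le_trans (ltW MN)].
Qed.

Lemma integrable_fintype (I : finType) (r : T -> I) (f : I -> R) :
  (forall i, measurable (r @^-1` [set i])) ->
  nu.-integrable setT (EFin \o (f \o r)).
Proof.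
move=> mr; apply: (@bounded_integrable _ (\sum_i `|f i|)).
  exact: measurable_fun_fintype.
move=> x /=; rewrite (bigD1 (r x))//= lerDl.
exact: sumr_ge0.
Qed.

Lemma measurable_neq_fintype (I : finType) (r r' : T -> I) :
  (forall i, measurable (r @^-1` [set i])) ->
  (forall i, measurable (r' @^-1` [set i])) ->
  measurable [set x | r x <> r' x].
Proof.
move=> mr mr'; apply: (@measurableC _ _ [set x | r x = r' x]).
rewrite (_ : [set x | _] =
    \bigcup_(i in [set: I]) (r @^-1` [set i] `&` r' @^-1` [set i])).
  by apply: fin_bigcup_measurable => // i _; exact: measurableI.
apply/seteqP; split => x /=; first by move=> e; exists (r x).
by move=> [i _ [/= -> ->]].
Qed.

Lemma measurable_preimage_fintype (I J : finType) (r : T -> I) (g : I -> J) :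
  (forall i, measurable (r @^-1` [set i])) ->
  forall j, measurable ((g \o r) @^-1` [set j]).
Proof.
move=> mr j.
rewrite (_ : _ @^-1` _ = \bigcup_(i in [set i | g i = j]) r @^-1` [set i]).
  by apply: fin_bigcup_measurable.
by apply/seteqP; split => [x /= gx|x [i /= gi ->]//]; exists (r x).
Qed.

End FiniteValued.

Section Gibbs.
Context {R : realType}.

Lemma ln2_gt0 : 0 < ln 2 :> R.
Proof. by apply: ln_gt0; lra. Qed.

(** Pointwise form of Gibbs' inequality: [ln t <= t - 1] at [t = q / p], multiplied by [p]. The
    correction [q - p] sums to at most 0 when [p] is a probability and [q] a subprobability. *)
Lemma Nplog2p_le (p q : R) : 0 <= p -> 0 < q ->
  - (p * log2 p) <= - (p * log2 q) + (q - p) / ln 2.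
Proof.
rewrite le_eqVlt => /predU1P[<- q0|p0 q0].
  by rewrite !mul0r oppr0 add0r addr0 divr_ge0 // ltW // ln2_gt0.
rewrite /log2 !mulrA -!mulNr -mulrDl ler_pM2r ?invr_gt0 ?ln2_gt0//.
have : ln (q / p) <= q / p - 1.
  have := @le_ln1Dx R (q / p - 1); rewrite addrCA subrr addr0; apply.
  by rewrite ltrBrDl subrr divr_gt0.
rewrite ln_div ?posrE// => /(ler_wpM2l (ltW p0)).
rewrite mulrBr [X in _ <= X]mulrBr mulr1 [p * (q / p)]mulrC divfK ?gt_eqF//; lra.
Qed.

End Gibbs.

Section AlmostEverywhere.
Context {d : measure_display} {T : measurableType d} {R : realType}.
Variable (mu : {measure set T -> \bar R}).

(** Replacing [g] by the maximum of [f] and [g], which agrees with it almost everywhere, makes the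
    comparison pointwise. *)
Lemma ae_le_integral (f g : T -> \bar R) :
  mu.-integrable setT f -> mu.-integrable setT g ->
  {ae mu, forall x, (f x <= g x)%E} ->
  (\int[mu]_x f x <= \int[mu]_x g x)%E.
Proof.
move=> intf intg fg.
have mf := measurable_int _ intf; have mg := measurable_int _ intg.
have gE : ae_eq mu setT g (fun x => maxe (f x) (g x)).
  by apply: filterS fg => x fgx _; apply/esym/max_idPr.
have mm : measurable_fun setT (fun x => maxe (f x) (g x)) by exact: measurable_maxe.
have -> : (\int[mu]_x g x = \int[mu]_x maxe (f x) (g x))%E.
  exact: ae_eq_integral.
apply: le_integral => //.
  apply/integrableP; split => //; move/integrableP : (intg) => [_].
  rewrite (_ : (\int[mu]_x `|g x| = \int[mu]_x `|maxe (f x) (g x)|)%E)//.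
  apply: ae_eq_integral => //; [exact: measurableT_comp..|].
  by apply: filterS gE => x /= gx xT; rewrite -gx.
by move=> x _; rewrite le_max lexx.
Qed.

Lemma measure_eq_off_null (A B N : set T) :
  measurable A -> measurable B -> measurable N -> mu N = 0%E ->
  (forall t, ~ N t -> A t <-> B t) -> mu A = mu B.
Proof.
move=> mA mB mN N0 AB.
have null C : measurable C -> mu C = mu (C `\` N).
  move=> mC; rewrite (measureDI mu mC mN).
  rewrite (@subset_measure0 _ _ _ mu (C `&` N) N) ?adde0//.
  exact: measurableI.
rewrite (null A)// (null B)//; congr (mu _); apply/seteqP; split => t [? Nt];
  by split => //; apply/AB.
Qed.

End AlmostEverywhere.

(** * Conditional entropy and code lengths *)

Section EntropyCode.
Context {d : measure_display} {T : measurableType d} {R : realType}.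
Variables (nu : probability T R) (F : set (set T)).
Hypotheses (sF : sigma_algebra setT F) (mF : F `<=` measurable).

(** The tower property for a weight that factors through a finite-valued [F]-measurable map:
    splitting over the fibres of [s] reduces it to the defining property of [p] on each fibre. *)
Lemma integral_cond_prob_fintype (A : set T) (p : T -> R) (J : finType)
    (s : T -> J) (h : J -> R) :
  measurable A -> measurable_fun setT p -> (forall x, 0 <= p x <= 1) ->
  (forall B, F B -> (\int[nu]_(x in B) (p x)%:E)%E = nu (A `&` B)) ->
  (forall j, F (s @^-1` [set j])) ->
  (\int[nu]_x (p x * h (s x))%:E = \int[nu]_x (\1_A x * h (s x))%:E)%E.
Proof.
move=> mA mp p01 pA Fs.
have ms j : measurable (s @^-1` [set j]) by exact: mF.
have expand (f : T -> R) : measurable_fun setT f -> (forall x, 0 <= f x <= 1) ->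
    (\int[nu]_x (f x * h (s x))%:E =
     \sum_j (h j)%:E * \int[nu]_(x in s @^-1` [set j]) (f x)%:E)%E.
  move=> mf f01.
  have intf : nu.-integrable setT (EFin \o f).
    apply: (@bounded_integrable _ _ _ _ _ 1) => // x.
    by have /andP[f0 f1] := f01 x; rewrite ger0_norm.
  have intp j : nu.-integrable setT ((EFin \o f) \_ (s @^-1` [set j])).
    by apply/(integrable_mkcond _ (ms j)); apply: (integrableS measurableT).
  transitivity (\int[nu]_x (\sum_j (h j)%:E * (EFin \o f) \_ (s @^-1` [set j]) x))%E.
    apply: eq_integral => x _.
    rewrite (bigD1 (s x))//= big1 ?adde0.
      by rewrite patchE ifT ?inE//= -EFinM mulrC.
    move=> j jsx; rewrite patchE ifF ?mule0//.
    by apply/negbTE; rewrite notin_setE /= => /eqP; rewrite eq_sym (negbTE jsx).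
  rewrite integral_sum//.
    by apply: eq_bigr => j _; rewrite integralZl// -integral_mkcond.
  by move=> j; exact: integrableZl.
rewrite expand// expand.
- apply: eq_bigr => j _; congr (_ * _)%E.
  by rewrite pA// integral_indic.
- exact: measurable_indic.
- by move=> x; rewrite indicE; case: (_ \in _); rewrite ?lexx ler01.
Qed.

Lemma measurable_Nplog2p (f : T -> R) : measurable_fun setT f ->
  measurable_fun setT (fun x => - (f x * log2 (f x))).
Proof.
move=> mf; apply: measurableT_comp => //; apply: measurable_funM => //.
apply: measurable_funM => //.
exact: (measurableT_comp (@measurable_ln R)).
Qed.

Lemma cond_entropy_is_cond_prob (I : finType) (Q : I -> set T) (p : I -> T -> R) :
  (forall i, measurable (Q i)) -> (forall i, is_cond_prob nu F (Q i) (p i)) ->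
  cond_entropy nu F Q = (\int[nu]_x (\sum_i - (p i x * log2 (p i x)))%:E)%E.
Proof.
move=> mQ pQ; have cQ i := cond_probP nu sF mF (mQ i).
have mfun A f : is_cond_prob nu F A f -> measurable_fun setT f.
  by move=> [mf _ _]; exact: measurable_fun_subsigma mf.
apply: ae_eq_integral => //.
- apply/measurable_EFinP; apply: measurable_sum => i; apply: measurable_Nplog2p.
  exact: mfun (cQ i).
- apply/measurable_EFinP; apply: measurable_sum => i; apply: measurable_Nplog2p.
  exact: mfun (pQ i).
- have : {ae nu, forall x, forall i, cond_prob nu F (Q i) x = p i x}.
    by apply: filter_forall => i; exact: (is_cond_prob_unique sF mF (cQ i) (pQ i)).
  apply: filterS => x H _; congr (_%:E).
  by apply: eq_bigr => i _; rewrite H.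
Qed.

Lemma Nplog2p_ge0 (p : R) : 0 <= p <= 1 -> 0 <= - (p * log2 p).
Proof.
move=> /andP[p0 p1]; rewrite -mulrN mulr_ge0// /log2 -mulNr divr_ge0 ?(ltW ln2_gt0)//.
by rewrite oppr_ge0 ln_le0.
Qed.

Lemma cond_entropy_ge0 (I : finType) (Q : I -> set T) :
  (forall i, measurable (Q i)) -> (0 <= cond_entropy nu F Q)%E.
Proof.
move=> mQ; have /choice[p pP] i := is_cond_prob_01 nu sF mF (mQ i).
rewrite (cond_entropy_is_cond_prob mQ (fun i => (pP i).1)).
apply: integral_ge0 => x _; rewrite lee_fin sumr_ge0// => i _.
exact: Nplog2p_ge0 ((pP i).2 x).
Qed.

(** Here [s] is the part of the phase that the code reads, [q _ j] a subprobability on cells, and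
    [- log2 q] the codeword length. Gibbs' inequality bounds the entropy by the mean of [- log2 q]
    under the conditional law; the tower property then replaces that law by the indicator of the
    cell, leaving the length of the word for the cell that contains [x]. *)
Lemma cond_entropy_le_code (I J : finType) (r : T -> I) (s : T -> J)
    (q : I -> J -> R) (L : T -> R) :
  (forall i, measurable (r @^-1` [set i])) ->
  (forall j, F (s @^-1` [set j])) ->
  (forall i j, 0 <= q i j) -> (forall j, \sum_i q i j <= 1) ->
  nu.-integrable setT (EFin \o L) ->
  {ae nu, forall x, 0 < q (r x) (s x) /\ - log2 (q (r x) (s x)) <= L x} ->
  (cond_entropy nu F (fun i => r @^-1` [set i]) <= \int[nu]_x (L x)%:E)%E.
Proof.
move=> mr Fs q0 q1 intL qL.
have ms j : measurable (s @^-1` [set j]) by exact: mF.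
have /choice[p pP] i := is_cond_prob_01 nu sF mF (mr i).
have p01 i : forall x, 0 <= p i x <= 1 := (pP i).2.
have pE i := (pP i).1.
have mp i : measurable_fun setT (p i).
  by have [mpi _ _] := pE i; exact: measurable_fun_subsigma mpi.
rewrite (cond_entropy_is_cond_prob mr pE).
apply/lee_addgt0Pr => e e0.
pose c : R := #|I|%:R.
(* The added mass [c * e'] must cost at most [e] after division by [ln 2]; dividing by [c + 1] also
   covers an empty [I]. *)
pose e' : R := e * ln 2 / (c + 1).
have c1 : 0 < c + 1 :> R by rewrite ltr_wpDl.
have e'0 : 0 < e' by rewrite divr_gt0// mulr_gt0// ln2_gt0.
(* [log2 0 = 0], so Gibbs' inequality is applied to a positive perturbation. *)
pose q' i j := q i j + e'.
have q'0 i j : 0 < q' i j by rewrite ltr_wpDl.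
pose h i j := - log2 (q' i j) - (ln 2)^-1.
pose k i j := q' i j / ln 2.
have ik i : nu.-integrable setT (EFin \o (k i \o s)) by exact: integrable_fintype.
have iph i (f : T -> R) : measurable_fun setT f -> (forall x, 0 <= f x <= 1) ->
    nu.-integrable setT (EFin \o (fun x => f x * h i (s x))).
  move=> mf f01; apply: (@bounded_integrable _ _ _ _ _ (\sum_j `|h i j|)).
    by apply: measurable_funM => //; exact: measurable_fun_fintype.
  move=> x; have /andP[f0 f1] := f01 x; rewrite normrM (ger0_norm f0).
  apply: le_trans (_ : `|h i (s x)| <= _); first by rewrite ler_piMl.
  by rewrite (bigD1 (s x))//= lerDl sumr_ge0.
have m1 i : measurable_fun setT (\1_(r @^-1` [set i]) : T -> R).
  exact: measurable_indic.
have b1 i x : 0 <= (\1_(r @^-1` [set i]) : T -> R) x <= 1.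
  by rewrite indicE; case: (_ \in _); rewrite ?lexx ler01.
have iG i (f : T -> R) : measurable_fun setT f -> (forall x, 0 <= f x <= 1) ->
    nu.-integrable setT (fun x => (f x * h i (s x))%:E + (k i (s x))%:E)%E.
  by move=> mf f01; apply: integrableD => //; [exact: (iph i f mf f01)|exact: ik].
apply: (@le_trans _ _ (\int[nu]_x (\sum_i ((p i x * h i (s x))%:E + (k i (s x))%:E)))%E).
  apply: le_integral => //.
  - apply: (@bounded_integrable _ _ _ _ _ (\sum_(i : I) (ln 2)^-1)).
      by apply: measurable_sum => i; exact: measurable_Nplog2p.
    move=> x; apply: le_trans (ler_norm_sum _ _ _) _; apply: ler_sum => i _.
    have /andP[p0 p1] := p01 i x.
    rewrite ger0_norm.
      apply: le_trans (Nplog2p_le p0 ltr01) _.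
      rewrite /log2 ln1 mul0r mulr0 oppr0 add0r ler_piMl ?invr_ge0 ?(ltW ln2_gt0)//.
      by rewrite lerBlDr lerDl.
    by apply: Nplog2p_ge0; exact: p01.
  - by apply: integrable_sum => // i _; exact: iG.
  - move=> x _; rewrite -sumEFin; apply: lee_sum => i _.
    have /andP[p0 p1] := p01 i x.
    rewrite -EFinD lee_fin; apply: le_trans (Nplog2p_le p0 (q'0 i (s x))) _.
    rewrite /h /k; lra.
rewrite integral_sum//; last by move=> i; exact: iG.
rewrite (eq_bigr (fun i => \int[nu]_x
    ((\1_(r @^-1` [set i]) x * h i (s x))%:E + (k i (s x))%:E)))%E; last first.
  move=> i _; have [_ _ pEi] := pE i.
  rewrite integralD//; [|exact: (iph i _ (mp i) (p01 i))|exact: ik].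
  rewrite integralD//; [|exact: (iph i _ (m1 i) (b1 i))|exact: ik].
  by rewrite (integral_cond_prob_fintype _ (mr i)).
rewrite -integral_sum//; last by move=> i; exact: iG.
rewrite -[e%:E]mule1 -(@probability_setT _ _ _ nu) -integral_cst//.
rewrite -integralD//; last first.
  exact: finite_measure_integrable_cst.
apply: ae_le_integral.
- by apply: integrable_sum => // i _; exact: iG.
- by apply: integrableD => //; exact: finite_measure_integrable_cst.
- apply: filterS qL => x [q_gt0 qLx].
  under eq_bigr do rewrite -EFinD; rewrite sumEFin -EFinD lee_fin.
  rewrite big_split/= (bigD1 (r x))//= big1 ?addr0; last first.
    move=> i irx; rewrite indicE (_ : _ \in _ = false) ?mul0r//.
    by apply/negbTE; rewrite notin_setE /= => /eqP; rewrite eq_sym (negbTE irx).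
  rewrite indicE mem_set// mul1r /k -mulr_suml big_split/= sumr_const -[e' *+ _]mulr_natl.
  rewrite -/c /h.
  have le1 : - log2 (q' (r x) (s x)) <= L x.
    apply: le_trans qLx; rewrite lerN2 /log2 ler_pM2r ?invr_gt0 ?ln2_gt0//.
    by rewrite ler_ln ?posrE// /q' lerDl ltW.
  have le2 : c * e' / ln 2 <= e.
    rewrite ler_pdivrMr ?ln2_gt0// -[e * ln 2](@divfK _ (c + 1)) ?gt_eqF// -/e'.
    by rewrite mulrC ler_pM2l// lerDl.
  have le3 : (\sum_i q i (s x)) / ln 2 <= (ln 2)^-1.
    by rewrite ler_piMl// invr_ge0 ltW// ln2_gt0.
  rewrite mulrDl; lra.
Qed.

End EntropyCode.

(** * Borel sets of product spaces *)

Section ProductBorel.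
Variables (I : choiceType) (K : I -> topologicalType) (f : I -> nat).
Hypothesis f_inj : injective f.
Implicit Types x y : prod_topology K.

Let agree n x y := forall i, (f i < n)%N -> y i = x i.

Lemma prod_topology_nbhs x (U : set (prod_topology K)) : nbhs x U ->
  exists n, forall y, agree n x y -> U y.
Proof.
pose B n : set (prod_topology K) := agree n x.
have FB : Filter (filter_from setT B).
  apply: filter_from_filter; first by exists 0%N.
  move=> m n _ _; exists (maxn m n) => // y Bmn; split => i fi;
    apply: Bmn; apply: leq_trans fi _; [exact: leq_maxl|exact: leq_maxr].
suff : filter_from setT B --> x.
  by move=> cB /cB [n _ BU]; exists n => y xy; exact: BU.
apply/cvg_sup => i V [W] [[N] oN <-] Nxi NV.
exists (f i).+1 => // y yx; apply: NV => /=.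
by rewrite /= yx.
Qed.

Context {d : measure_display} {T : measurableType d} (h : T -> prod_topology K).
Hypotheses (mh : forall i (c : K i), measurable [set t | h t i = c])
  (K_count : forall i, countable [set: K i]).

(** Induction on the number of relevant coordinates: freezing the coordinate numbered [n] at a value
    [c] leaves a set that depends on fewer coordinates, and the preimage is a countable union over
    [c]. *)
Let measurable_finite n (A : set (prod_topology K)) :
  (forall x y, agree n x y -> A x -> A y) -> measurable (h @^-1` A).
Proof.
elim: n A => [|n IHn] A AP.
  have [->|/set0P[x Ax]] := eqVneq A set0; first by rewrite preimage_set0.
  rewrite (_ : A = setT) ?preimage_setT//; apply/seteqP; split => // y _.
  exact: AP Ax.
have [[i fi]|nof] := pselect (exists i, f i = n); last first.
  apply: IHn => x y xy; apply: AP => i; rewrite ltnS leq_eqVlt => /orP[/eqP fi|/xy//].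
  by exfalso; apply: nof; exists i.
pose A' (c : K i) : set (prod_topology K) := [set x | A (dfwith x i c)].
have mA' c : measurable (h @^-1` A' c).
  apply: IHn => x y xy; apply: AP => j; rewrite ltnS leq_eqVlt => /orP[/eqP fj|fj].
    have -> : j = i by apply: f_inj; rewrite fi.
    by rewrite !dfwithin.
  have ij : i != j by apply: contraTneq fj => <-; rewrite fi ltnn.
  by rewrite !dfwithout// xy.
have dfE (x : prod_topology K) : dfwith x i (x i) = x :> prod_topology K.
  by apply: functional_extensionality_dep => j; case: dfwithP.
rewrite (_ : h @^-1` A = \bigcup_c ([set t | h t i = c] `&` h @^-1` A' c)).
  by apply: countable_bigcupT_measurable => // c; exact: measurableI.
apply/seteqP; split => [t Aht|t [c _] [/= <-]]; last by rewrite /A' /= dfE.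
by exists (h t i) => //; split => //; rewrite /A' /= dfE.
Qed.

(** An open set is the union over [n] of those of its points whose whole [agree n] class lies inside
    it, and each of these sets depends on finitely many coordinates. Measurability into the Borel
    sets of a product can thus be checked coordinatewise. *)
Lemma measurable_preimage_open (U : set (prod_topology K)) :
  open U -> measurable (h @^-1` U).
Proof.
move=> oU; rewrite (_ : U = \bigcup_n [set x | forall y, agree n x y -> U y]).
  rewrite preimage_bigcup; apply: bigcupT_measurable => n.
  apply: (@measurable_finite n) => x y xy Ux z yz; apply: Ux => i fi.
  by rewrite yz// xy.
apply/seteqP; split => [x Ux|x [n _]]; last by apply.
have [n nU] : exists n, forall y, agree n x y -> U y.
  by apply: prod_topology_nbhs; exact: open_nbhs_nbhs.
by exists n.
Qed.

End ProductBorel.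

Section Coordinates.
Variable K : fieldExtType rat.
Variable b : nat -> idealr (OK K).

(** The coordinates of [a] in a basis of [K] form a row of rationals, an element of a countable
    type. *)
Definition OK_code (a : OK K) : nat := choice.pickle (VectorInternalTheory.v2r (val a)).

Lemma OK_code_inj : injective OK_code.
Proof.
move=> a a' /(pcan_inj choice.pickleK) /(can_inj VectorInternalTheory.v2rK).
exact: val_inj.
Qed.

Lemma countable_OK : countable [set: OK K].
Proof. by apply/countable_injP; exists OK_code => a a' _ _ /OK_code_inj. Qed.

Lemma countable_quot l : countable [set: {ideal_quot (b l)}].
Proof.
apply/countable_injP; exists (OK_code \o repr) => u v _ _ /OK_code_inj uv.
by rewrite -[u]reprK -[v]reprK uv.
Qed.

Lemma measurable_config_coord a : measurable [set x : borel (config K) | x a].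
Proof.
apply: sub_sigma_algebra.
rewrite -[X in open X]/((@proj _ (fun=> bool) a) @^-1` [set true]).
apply: (@open_comp (config K) bool); last exact: discrete_open.
by move=> x _; exact: proj_continuous.
Qed.

Lemma measurable_phase_coord l (c : {ideal_quot (b l)}) :
  measurable [set g : borel (phase_group b) | g l = c].
Proof.
apply: sub_sigma_algebra.
pose X l := discrete_topology {ideal_quot (b l)}.
rewrite -[X in open X]/((@proj _ X l) @^-1` [set c]).
apply: (@open_comp (phase_group b) (X l)); last exact: discrete_open.
by move=> x _; exact: proj_continuous.
Qed.

Context {d : measure_display} {T : measurableType d}.

Lemma measurable_fun_config (h : T -> borel (config K)) :
  (forall a, measurable [set t | h t a]) -> measurable_fun setT h.
Proof.
move=> mh.
apply: (@measurability _ _ _ (borel (config K)) setT h (@open (config K))) => //.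
move=> _ [U oU <-]; rewrite setTI.
apply: (measurable_preimage_open OK_code_inj) => // [a c|a]; last exact: countableP.
case: c; first exact: mh.
rewrite (_ : [set t | _] = ~` [set t | h t a]); first exact: measurableC.
by apply/seteqP; split => t /=; [move=> -> | case: (h t a)].
Qed.

Lemma measurable_fun_phase (h : T -> borel (phase_group b)) :
  (forall l (c : {ideal_quot (b l)}), measurable [set t | h t l = c]) ->
  measurable_fun setT h.
Proof.
move=> mh; apply: (@measurability _ _ _ (borel (phase_group b)) setT h
  (@open (phase_group b))) => // _ [U oU <-]; rewrite setTI.
apply: (@measurable_preimage_open nat _ id) => //; exact: countable_quot.
Qed.

End Coordinates.

Lemma measurable_preimageT d1 d2 (T1 : measurableType d1) (T2 : measurableType d2)
  (f : T1 -> T2) B : measurable_fun setT f -> measurable B -> measurable (f @^-1` B).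
Proof. by move=> mf mB; rewrite -[X in measurable X]setTI; exact: mf. Qed.

Section CountableMeasurable.
Context {d : measure_display} {T : measurableType d}.

Lemma measurable_forall (I : Type) (P : I -> T -> Prop) : countable [set: I] ->
  (forall i, measurable [set t | P i t]) -> measurable [set t | forall i, P i t].
Proof.
move=> cI mP.
rewrite (_ : [set _ | _] = ~` \bigcup_i ~` [set t | P i t]).
  apply: measurableC; apply: countable_bigcupT_measurable => // i.
  exact: measurableC.
rewrite setC_bigcup; apply/seteqP; split => t /=.
  by move=> Pt i _; rewrite setCK.
by move=> Pt i; have := Pt i Logic.I; rewrite setCK.
Qed.

Lemma measurable_exists (I : Type) (P : I -> T -> Prop) : countable [set: I] ->
  (forall i, measurable [set t | P i t]) -> measurable [set t | exists i, P i t].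
Proof.
move=> cI mP.
rewrite (_ : [set _ | _] = \bigcup_i [set t | P i t]).
  exact: countable_bigcupT_measurable.
by apply/seteqP; split => t /= [i]; exists i.
Qed.

Lemma measurable_constP (p : Prop) : measurable [set t : T | p].
Proof.
have [pT|pF] := pselect p.
  by rewrite (_ : [set _ | _] = setT)//; apply/seteqP; split.
by rewrite (_ : [set _ | _] = set0)//; apply/seteqP; split.
Qed.

Lemma measurable_imply (P Q : T -> Prop) :
  measurable [set t | P t] -> measurable [set t | Q t] ->
  measurable [set t | P t -> Q t].
Proof.
move=> mP mQ.
rewrite (_ : [set _ | _] = ~` [set t | P t] `|` [set t | Q t]).
  by apply: measurableU => //; exact: measurableC.
apply/seteqP; split => t /= => [PQ|[]//].
by have [/PQ|] := pselect (P t); [right|left].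
Qed.

Lemma measurable_not (P : T -> Prop) :
  measurable [set t | P t] -> measurable [set t | ~ P t].
Proof. exact: (@measurableC _ _ [set t | P t]). Qed.

Lemma measurable_conj (P Q : T -> Prop) :
  measurable [set t | P t] -> measurable [set t | Q t] ->
  measurable [set t | P t /\ Q t].
Proof. by move=> mP mQ; exact: (measurableI [set t | P t] [set t | Q t]). Qed.

End CountableMeasurable.

(** * The phase map *)

Section Phases.
Local Open Scope quotient_scope.
Variables (K : fieldExtType rat) (b : nat -> idealr (OK K)).
Local Notation res l a := (\pi_{ideal_quot (b l)} a).
Implicit Types (x : borel (config K)) (g : borel (phase_group b)).

Definition misses l x (r : {ideal_quot (b l)}) : Prop :=
  forall a, res l a = r -> ~ supp x a.

Arguments misses : clear implicits.

Hypothesis fin_quot : forall l, finite_set [set: {ideal_quot (b l)}].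

(** Missed and met classes partition the finite quotient, so the count is maximal below the norm
    exactly when one class is missed. The truncated subtraction is exact because the norm is
    positive. *)
Lemma num_residues_max x l :
  num_residues (supp x) (b l) = (ideal_norm (b l) - 1)%N <->
  exists r, misses l x r /\ forall r', misses l x r' -> r' = r.
Proof.
have finQ := fin_quot l.
set A := [set res l a | a in supp x].
have missE r : misses l x r <-> ~ A r.
  split=> [xr [a xa ar]|nAr a ar xa]; first exact: xr xa.
  by apply: nAr; exists a.
have finA : finite_set A by exact: sub_finite_set finQ.
have finC : finite_set (~` A) by exact: sub_finite_set finQ.
have cardE : (#|` fset_set (~` A)| + #|` fset_set A| = ideal_norm (b l))%N.
  rewrite /ideal_norm -setTD fset_setD// cardfsD.
  have sub : (fset_set A `<=` fset_set [set: {ideal_quot (b l)}])%fset.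
    by rewrite -fset_set_sub.
  move: (fsubset_leq_card sub) => le; move/fsetIidPr : sub => ->.
  by rewrite subnK.
rewrite /num_residues -/A -cardE.
have norm_gt0 : (0 < #|` fset_set (~` A)| + #|` fset_set A|)%N.
  rewrite cardE /ideal_norm cardfs_gt0; apply/fset0Pn; exists 0.
  by rewrite in_fset_set// inE.
transitivity (#|` fset_set (~` A)| = 1%N); first by lia.
split.
  move=> /eqP/cardfs1P[r rE].
  have rP r' : misses l x r' <-> r' = r.
    rewrite missE; have := in_fset_set finC r'; rewrite rE inE => rr'.
    split=> [nA|r'r]; first by apply/eqP; rewrite rr' inE.
    have : r' \in ~` A by rewrite -rr' r'r.
    by move=> /set_mem.
  by exists r; split=> [|r' /rP//]; apply/rP.
move=> [r [xr xu]]; apply/eqP/cardfs1P; exists r; apply/fsetP => r'.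
rewrite in_fset_set// in_fset1; apply/idP/eqP => [|->].
  by move=> /set_mem/missE/xu.
by apply/mem_set/missE.
Qed.

Lemma YP x : Y b x <->
  forall l, exists r, misses l x r /\ forall r', misses l x r' -> r' = r.
Proof.
split=> [[_ Yx] l|Yx]; first exact/num_residues_max.
have e l : num_residues (supp x) (b l) = (ideal_norm (b l) - 1)%N.
  exact/num_residues_max.
split=> // l; rewrite e -ltnS subn1 prednK//.
rewrite /ideal_norm cardfs_gt0; apply/fset0Pn; exists 0.
by rewrite (in_fset_set (fin_quot l)) mem_set.
Qed.

Lemma missing_classP x l r : Y b x -> misses l x r <-> missing_class b x l = r.
Proof.
move=> /YP/(_ l)[r0 [xr0 xu]].
have -> : missing_class b x l = r0.
  rewrite /missing_class; case: xgetP => [r' _ /xu//|/(_ r0)]; by [].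
by split => [/xu|<-].
Qed.

Lemma le_varphi_theta x a : Y b x -> x a -> varphi (theta b x) a.
Proof.
move=> Yx xa; apply/asboolP => l; rewrite /theta mem_set//.
apply: contraPneq xa => /eqP; rewrite addrC subr_eq0 => /eqP ar.
by have /(missing_classP _ Yx) /(_ a ar) := erefl (missing_class b x l).
Qed.

(** The class [- g l] is missed whatever [x] is; on [Y] the missed class is unique, so the phase [g]
    can be read off. *)
Lemma theta_Phi g x : Y b (Phi (g, x)) -> theta b (Phi (g, x)) = g.
Proof.
move=> Yx; apply: functional_extensionality_dep => l.
rewrite /theta mem_set//.
suff /(missing_classP _ Yx) -> : misses l (Phi (g, x)) (- g l : {ideal_quot (b l)}).
  by rewrite opprK.
move=> a ag /andP[/asboolP /(_ l)]; rewrite ag subrr eqxx.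
by [].
Qed.

Lemma measurable_misses l (r : {ideal_quot (b l)}) :
  measurable [set x | misses l x r].
Proof.
apply: measurable_forall => [|a]; first exact: countable_OK.
apply: measurable_imply; first exact: measurable_constP.
apply: measurable_not.
exact: measurable_config_coord.
Qed.

Lemma measurable_Y : measurable (Y b).
Proof.
rewrite (_ : Y b = [set x | forall l, exists r, misses l x r /\
    forall r', misses l x r' -> r' = r]); last first.
  by apply/seteqP; split => x /YP.
apply: measurable_forall => // l.
apply: measurable_exists => [|r]; first exact: countable_quot.
apply: measurable_conj; first exact: measurable_misses.
apply: measurable_forall => [|r']; first exact: countable_quot.
have [->|r'r] := eqVneq r' r.
  by rewrite (_ : [set _ | _] = setT)//; apply/seteqP; split.
rewrite (_ : [set _ | _] = [set x | ~ misses l x r']).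
  by apply: measurable_not; exact: measurable_misses.
by apply/seteqP; split => x /= xr => [/xr/eqP|/xr//]; rewrite (negbTE r'r).
Qed.

Lemma measurable_theta : measurable_fun setT (theta b).
Proof.
apply: measurable_fun_phase => l c.
rewrite (_ : [set _ | _] = [set x | (Y b x -> misses l x (- c)) /\ (~ Y b x -> 0 = c)]).
  apply: measurable_conj; apply: measurable_imply.
  - exact: measurable_Y.
  - exact: measurable_misses.
  - by apply: measurable_not; exact: measurable_Y.
  - exact: measurable_constP.
apply/seteqP; split => x /=; rewrite /theta.
  case: ifPn => [/set_mem Yx <-|/negP xY <-]; split => // Yx'.
    by rewrite opprK; apply/missing_classP.
  by exfalso; apply: xY; apply: mem_set.
case: ifPn => [/set_mem Yx [/(_ Yx)/(missing_classP _ Yx) -> _]|xY [_]].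
  by rewrite opprK.
by apply=> /mem_set; exact/negP.
Qed.

Lemma sigma_algebra_F_theta : sigma_algebra setT (F_theta b).
Proof. exact/sigma_algebra_preimage/sigma_algebra_measurable. Qed.

Lemma F_theta_measurable : F_theta b `<=` measurable.
Proof. by move=> _ [A mA <-]; exact: measurable_theta. Qed.

Lemma measurable_varphi_coord a : measurable [set g | varphi (b := b) g a].
Proof.
rewrite (_ : [set _ | _] = [set g | forall l, ~ (g l = - res l a)]).
  apply: measurable_forall => // l; apply: measurable_not.
  exact: measurable_phase_coord.
apply/seteqP; split => g /=.
  by move=> /asboolP ga l gl; have := ga l; rewrite gl addNr eqxx.
move=> ga; apply/asboolP => l; rewrite addr_eq0; apply/eqP; exact: ga.
Qed.

Lemma measurable_varphi : measurable_fun setT (@varphi K b).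
Proof. by apply: measurable_fun_config => a; exact: measurable_varphi_coord. Qed.

Lemma measurable_Phi : measurable_fun setT (@Phi K b).
Proof.
apply: measurable_fun_config => a.
have -> : [set t | Phi t a] =
    [set g | varphi (b := b) g a] `*` [set x : borel (config K) | x a].
  by apply/seteqP; split => -[g x] /=; rewrite /Phi => /andP.
by apply: measurableX; [exact: measurable_varphi_coord|exact: measurable_config_coord].
Qed.

Lemma measurable_shift_map a : measurable_fun setT (@shift_map K a).
Proof. by apply: measurable_fun_config => c; exact: measurable_config_coord. Qed.

End Phases.

(** * Haar measure of the phases that allow given sites *)

Section Haar.
Local Open Scope quotient_scope.
Variables (K : fieldExtType rat) (b : nat -> idealr (OK K)) (R : realType).
Hypothesis fin_quot : forall l, finite_set [set: {ideal_quot (b l)}].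
Variable P : probability (borel (phase_group b)) R.
Hypothesis hP : is_haar P.
Implicit Types g h : borel (phase_group b).
Local Notation Q l := {ideal_quot (b l)}.
Local Notation res l a := (\pi_{ideal_quot (b l)} a).

Let N l : R := (ideal_norm (b l))%:R.

Let N_gt0 l : 0 < N l.
Proof.
rewrite ltr0n cardfs_gt0; apply/fset0Pn; exists 0.
by rewrite (in_fset_set (fin_quot l)) mem_set.
Qed.

Let avoid (t : forall l, Q l) n : set (borel (phase_group b)) :=
  [set g | forall l, (l < n)%N -> g l <> t l].

Let measurable_avoid t n : measurable (avoid t n).
Proof.
apply: measurable_forall => [|l]; first exact: countableP.
apply: measurable_imply; first exact: measurable_constP.
by apply: measurable_not; exact: measurable_phase_coord.
Qed.

Let at_coord n (c : Q n) : set (borel (phase_group b)) := [set g | g n = c].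

Let measurable_avoidI t n (c : Q n) :
  measurable (avoid t n `&` at_coord c).
Proof. by apply: measurableI => //; exact: measurable_phase_coord. Qed.

(** Translation by the element equal to [c] at [n] and 0 elsewhere carries one event to the other,
    since it does not move the coordinates below [n]. *)
Let haar_avoidI t n (c : Q n) :
  P (avoid t n `&` at_coord c) = P (avoid t n `&` at_coord (0 : Q n)).
Proof.
pose e (c : Q n) : borel (phase_group b) := dfwith (fun l => 0 : Q l) n c.
have eN l c' : (l < n)%N -> e c' l = 0.
  by move=> ln; rewrite /e dfwithout// gt_eqF.
rewrite -[RHS](hP (e c))//; congr (P _); apply/seteqP; split => g /=.
  move=> [ga gn]; pose g' := phase_add (e (- c)) g; exists g'.
    split => [l ln|].
      by rewrite /g' /phase_add eN// add0r; exact: ga.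
    by rewrite /at_coord /= /g' /phase_add /e dfwithin gn addNr.
  apply: functional_extensionality_dep => l; rewrite /g' /phase_add addrA.
  have [->|ln] := eqVneq l n; first by rewrite /e !dfwithin subrr add0r.
  by rewrite /e !dfwithout 1?eq_sym// !add0r.
move=> [h [ha hn] <-]; split => [l ln|].
  by rewrite /phase_add eN// add0r; exact: ha.
by rewrite /at_coord /= /phase_add /e dfwithin hn addr0.
Qed.

(** Independence of the coordinates is extracted from invariance: given the constraints below [n],
    all values at [n] are equally likely, so excluding one multiplies the probability by
    [1 - (N n)^-1]. *)
Lemma haar_avoid (t : forall l, Q l) n :
  P (avoid t n) = (\prod_(l < n) (1 - (N l)^-1))%:E.
Proof.
elim: n => [|n IHn].
  by rewrite big_ord0 (_ : avoid t 0 = setT) ?probability_setT//; apply/seteqP; split.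
pose p := P (avoid t n `&` at_coord (t n)).
have p_fin : p \is a fin_num by exact: fin_num_measure.
have AE : P (avoid t n) = ((N n)%:E * p)%E.
  rewrite (_ : avoid t n = \bigcup_(c in [set: Q n]) (avoid t n `&` at_coord c)).
    rewrite measure_fin_bigcup//=.
    - rewrite (eq_fsbigr (fun=> p)).
        rewrite fsbig_finite//= -(fineK p_fin) sumEFin big_const_seq.
        by rewrite count_predT iter_addr addr0 -mulr_natl EFinM.
      by move=> c _; rewrite /p !haar_avoidI.
    - by move=> c c' _ _ [g [[_ gc] [_ gc']]]; rewrite -[LHS]gc -[RHS]gc'.
  by apply/seteqP; split => [g ga|g [c _ []]//]; exists (g n).
have pE : p = ((\prod_(l < n) (1 - (N l)^-1)) / N n)%:E.
  move: AE; rewrite IHn -(fineK p_fin) -EFinM => -[->].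
  by rewrite mulrAC mulfV ?mul1r// gt_eqF.
rewrite big_ord_recr/= mulrBr mulr1 EFinB -IHn -pE.
rewrite (_ : avoid t n.+1 = avoid t n `\` (avoid t n `&` at_coord (t n))).
  rewrite measureD//; last by rewrite ltey_eq fin_num_measure.
  by rewrite setIA setIid.
apply/seteqP; split => [g ga|g [ga gn] l].
  split => [l ln|[_ gn]]; first by apply: ga; exact: ltnW.
  exact: ga gn.
rewrite ltnS leq_eqVlt => /orP[/eqP ->|]; last exact: ga.
by move=> gt; apply: gn.
Qed.

(** Continuity from above along the finite avoidance events, which also yields convergence of the
    partial products in [density]. *)
Lemma haar_varphi a : P [set g | varphi (b := b) g a] = (density b R)%:E.
Proof.
pose t l : Q l := - res l a.
have -> : [set g | varphi (b := b) g a] = \bigcap_n avoid t n.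
  apply/seteqP; split => g /=.
    move=> /asboolP ga n _ l _ gl; have := ga l.
    by rewrite gl addNr eqxx.
  move=> ga; apply/asboolP => l; rewrite addr_eq0; apply/eqP.
  exact: (ga l.+1 Logic.I l).
have cP : (P \o avoid t) n @[n --> \oo] --> P (\bigcap_n avoid t n).
  apply: nonincreasing_cvg_mu => //.
  - by rewrite ltey_eq fin_num_measure.
  - exact: bigcapT_measurable.
  - move=> m n mn; apply/subsetPset => g ga l lm; apply: ga.
    exact: leq_trans lm mn.
have Pfin : P (\bigcap_n avoid t n) \is a fin_num.
  by apply: fin_num_measure; exact: bigcapT_measurable.
rewrite -(fineK Pfin); congr (_%:E); apply/esym/cvg_lim => //.
move: cP; rewrite -(fineK Pfin) => /fine_cvg; apply: cvg_trans.
by apply: near_eq_cvg; apply: nearW => n; rewrite /= haar_avoid.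
Qed.

(** Moving the window by [t] has the same effect as translating the phase by the residues of [t]. *)
Lemma haar_varphi_translate (t : OK K) (E : {fset OK K}) :
  P [set g | forall c, c \in E -> varphi (b := b) g (t + c)] =
  P [set g | forall c, c \in E -> varphi (b := b) g c].
Proof.
have resD l a a' : res l (a + a') = res l a + res l a' by rewrite !piE.
pose tau : borel (phase_group b) := fun l => res l t.
rewrite -[LHS](hP tau).
  congr (P _); apply/seteqP; split => g /=.
    move=> [h ha <-] c /ha /asboolP hc; apply/asboolP => l.
    by have := hc l; rewrite resD addrCA addrA.
  move=> ga; pose g' : borel (phase_group b) := fun l => - tau l + g l; exists g'.
    move=> c /ga /asboolP gc; apply/asboolP => l; have := gc l.
    by rewrite resD /g' addrACA addNr add0r.
  by apply: functional_extensionality_dep => l; rewrite /g' /phase_add addrA subrr add0r.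
apply: measurable_forall => [|c].
  exact: countable_OK.
apply: measurable_imply; first exact: measurable_constP.
exact: measurable_varphi_coord.
Qed.

End Haar.

(** * Codes for windows *)

Section BlockCode.
Context {R : realType} {T : finType}.
Variable s : T -> bool.
Implicit Types (w : {ffun T -> bool}) (G : {ffun T -> bool} -> R) (r : seq T).

(* Law of the value [v] of a site; the site is forced to be empty unless [u]. *)
Definition coin (u v : bool) : R := if u then 2^-1 else (~~ v)%:R.

Definition coin_weight w : R := \prod_a coin (s a) (w a).

Lemma coin_ge0 u v : 0 <= coin u v.
Proof. by case: u; rewrite /coin ?invr_ge0 ?ler0n. Qed.

Lemma coin_sum u : coin u true + coin u false = 1.
Proof. by case: u; rewrite /coin /= ?add0r//; lra. Qed.

Lemma sum_coin_weight : \sum_w coin_weight w = 1.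
Proof.
rewrite -(bigA_distr_bigA (fun a v => coin (s a) v))/= big1// => a _.
by rewrite big_bool/= coin_sum.
Qed.

Lemma coin_weight_ge0 w : 0 <= coin_weight w.
Proof. by apply: prodr_ge0 => a _; exact: coin_ge0. Qed.

Lemma coin_weightE w : (forall a, w a -> s a) ->
  coin_weight w = 2^-1 ^+ #|[pred a | s a]|.
Proof.
move=> ws; rewrite /coin_weight -prodr_const (bigID [pred a | s a])/=.
rewrite [X in _ * X]big1 ?mulr1 => [|a sa].
  by apply: eq_bigr => a; rewrite /coin => ->.
by rewrite /coin (negbTE sa); case: (w a) (ws a) sa => // ->.
Qed.

Lemma coin_weight_eq0 w a : w a -> ~~ s a -> coin_weight w = 0.
Proof.
by move=> wa sa; rewrite /coin_weight (bigD1 a)//= /coin (negbTE sa) wa mul0r.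
Qed.

Definition indep_of (a : T) G :=
  forall w w', (forall c, c != a -> w c = w' c) -> G w = G w'.

(** Under [coin_weight] the site [a] is independent of every function of the other sites: flipping
    the bit at [a] matches the two half-sums of the remaining factors. *)
Lemma coin_weight_coord a G : indep_of a G ->
  \sum_w coin_weight w * ((w a)%:R * G w) =
  coin (s a) true * \sum_w coin_weight w * G w.
Proof.
move=> aG; pose wt' (w : {ffun T -> bool}) := \prod_(c | c != a) coin (s c) (w c).
have wtE w : coin_weight w = coin (s a) (w a) * wt' w.
  by rewrite /coin_weight (bigD1 a).
pose S v := \sum_(w : {ffun T -> bool} | w a == v) wt' w * G w.
pose flip w := [ffun c => if c == a then ~~ w c else w c] : {ffun T -> bool}.
have flipK : involutive flip.
  by move=> w; apply/ffunP => c; rewrite !ffunE; case: eqP => // _; exact: negbK.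
have SE : S false = S true.
  rewrite /S (reindex_inj (inv_inj flipK))/=; apply: eq_big => [w|w _].
    by rewrite ffunE eqxx; case: (w a).
  congr (_ * _).
    by apply: eq_bigr => c ca; rewrite ffunE (negbTE ca).
  by apply: aG => c ca; rewrite ffunE (negbTE ca).
have split (H : {ffun T -> bool} -> R) : \sum_w H w =
    \sum_(w : {ffun T -> bool} | w a == true) H w +
    \sum_(w : {ffun T -> bool} | w a == false) H w.
  rewrite (bigID [pred w : {ffun T -> bool} | w a == true])/=; congr (_ + _).
  by apply: eq_bigl => w; case: (w a).
rewrite !split [X in _ + X = _]big1 ?addr0; last first.
  by move=> w /eqP ->; rewrite mul0r mulr0.
have E v : \sum_(w : {ffun T -> bool} | w a == v) coin_weight w * G w =
    coin (s a) v * S v.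
  rewrite /S mulr_sumr; apply: eq_bigr => w /eqP wa.
  by rewrite wtE wa mulrA.
rewrite !E SE -mulrDl coin_sum mul1r -E.
by apply: eq_bigr => w /eqP ->; rewrite mul1r.
Qed.

Lemma coin_weight_block r G : uniq r -> {in r, forall a, indep_of a G} ->
  \sum_w coin_weight w * (\prod_(a <- r) (w a)%:R * G w) =
  \prod_(a <- r) coin (s a) true * \sum_w coin_weight w * G w.
Proof.
elim: r G => [|a r IH] G /=.
  by move=> _ _; rewrite big_nil mul1r; under eq_bigr do rewrite big_nil mul1r.
move=> /andP[ar ur] rG; rewrite big_cons.
under eq_bigr do rewrite big_cons -mulrA.
rewrite coin_weight_coord.
  rewrite IH ?mulrA// => c cr; apply: rG.
  by rewrite inE cr orbT.
move=> w w' ww'; congr (_ * _); last by apply: rG ww'; rewrite mem_head.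
apply: eq_big_seq => c cr; rewrite ww'//.
by apply: contraNneq ar => <-.
Qed.

(* The density tilted by [eta] towards the event that [w] contains the block; the
   subtracted product is the probability of that event, so the mean is 1. *)
Definition block_factor (eta : R) r w : R :=
  1 + eta * (\prod_(a <- r) (w a)%:R - \prod_(a <- r) coin (s a) true).

(** Disjoint blocks are independent under [coin_weight] and each factor has mean 1, so the tilted
    weight is again a probability. *)
Lemma sum_block_code eta (M : seq (seq T)) :
  {in M, forall r, uniq r} ->
  pairwise (fun r r' => ~~ has (mem r) r') M ->
  \sum_w coin_weight w * \prod_(r <- M) block_factor eta r w = 1.
Proof.
elim: M => [|r M IH] /=.
  by move=> _ _; under eq_bigr do rewrite big_nil mulr1; exact: sum_coin_weight.
move=> uM /andP[rM /IH{}IH].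
have {}IH := IH (fun r' r'M => uM r' (mem_behead (s := r :: M) r'M)).
under eq_bigr do rewrite big_cons.
set G := fun w => \prod_(r' <- M) block_factor eta r' w.
have rG : {in r, forall a, indep_of a G}.
  move=> a ar w w' ww'; apply: eq_big_seq => r' r'M.
  congr (1 + eta * (_ - _)); apply: eq_big_seq => c cr'; rewrite ww'//.
  apply: contraTneq cr' => ->.
  by move/allP: rM => /(_ _ r'M) /hasPn H; apply: contraL ar => /H.
transitivity ((1 - eta * \prod_(a <- r) coin (s a) true) * \sum_w coin_weight w * G w
  + eta * \sum_w coin_weight w * (\prod_(a <- r) (w a)%:R * G w)).
  rewrite !mulr_sumr -big_split/=; apply: eq_bigr => w _.
  by rewrite /block_factor -/(G w); ring.
rewrite coin_weight_block//; last by apply: uM; exact: mem_head.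
by rewrite /G IH; ring.
Qed.

End BlockCode.

Section Log2.
Context {R : realType}.

Lemma log2_prod (I : Type) (r : seq I) (f : I -> R) :
  (forall i, 0 < f i) -> log2 (\prod_(i <- r) f i) = \sum_(i <- r) log2 (f i).
Proof.
move=> f0; elim: r => [|i r IH]; first by rewrite !big_nil /log2 ln1 mul0r.
rewrite !big_cons -IH /log2 lnM ?mulrDl// posrE//.
exact: prodr_gt0.
Qed.

Lemma log2_gt0_le (x y : R) : 0 < x -> x <= y -> log2 x <= log2 y.
Proof.
move=> x0 xy; rewrite /log2 ler_pM2r ?invr_gt0 ?ln2_gt0//.
by rewrite ler_ln// posrE// (lt_le_trans x0).
Qed.

Lemma log2_invX n : log2 (2^-1 ^+ n : R) = - n%:R.
Proof.
rewrite /log2 exprVn lnV ?posrE ?exprn_gt0// lnXn//.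
by rewrite -[ln 2 *+ n]mulr_natl mulNr mulfK ?gt_eqF ?ln2_gt0.
Qed.

(** The law is uniform on the words supported on allowed sites, and the remaining words have weight
    0 and contribute nothing. *)
Lemma entropy_coin_weight (T : finType) (s : T -> bool) :
  \sum_w - (coin_weight s w * log2 (coin_weight s w : R)) = #|[pred a | s a]|%:R.
Proof.
transitivity ((\sum_w coin_weight s w) * #|[pred a | s a]|%:R : R); last first.
  by rewrite sum_coin_weight mul1r.
rewrite mulr_suml; apply: eq_bigr => w _.
have [ws|/existsNP[a /not_implyP[wa /negP sa]]] := pselect (forall a, w a -> s a).
  by rewrite {2}coin_weightE// log2_invX mulrN opprK.
by rewrite (coin_weight_eq0 wa sa) !mul0r oppr0.
Qed.

(** From [ln t <= t - 1] at the inverse of [1 + y]; what remains is that [y ^+ 2 * (1 + 2 * y)] is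
    nonnegative, whence the bound one half. *)
Lemma ln1D_ge (y : R) : `|y| <= 2^-1 -> y - 2 * y ^+ 2 <= ln (1 + y).
Proof.
rewrite ler_norml => /andP[y1 y2].
have y0 : 0 < 1 + y by lra.
have -> : 1 + y = (1 + y)^-1^-1 by rewrite invrK.
rewrite lnV ?posrE ?invr_gt0//.
have := @le_ln1Dx R ((1 + y)^-1 - 1); rewrite addrCA subrr addr0 => H.
have {}H : ln (1 + y)^-1 <= (1 + y)^-1 - 1.
  by apply: H; rewrite ltrBrDl subrr invr_gt0.
suff : (1 + y)^-1 - 1 <= 2 * y ^+ 2 - y by lra.
rewrite -(ler_pM2r y0) mulrBl mulVf ?gt_eqF//; nra.
Qed.

End Log2.

Section SimpleComb.
Context {d : measure_display} {T : measurableType d} {R : realType}.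
Variable nu : probability T R.

(** The bounds on code lengths have this form, so their integrals reduce to finitely many
    probabilities. *)
Definition simple_comb (r : seq (R * set T)) (x : T) : R :=
  \sum_(p <- r) p.1 * \1_(p.2) x.

Lemma integral_simple_comb r : (forall p, p \in r -> measurable p.2) ->
  nu.-integrable setT (EFin \o simple_comb r) /\
  (\int[nu]_x (simple_comb r x)%:E)%E = (\sum_(p <- r) p.1 * fine (nu p.2))%:E.
Proof.
elim: r => [|p r IH] mr.
  rewrite /simple_comb; split.
    by under eq_fun do rewrite big_nil; exact: integrable0.
  by under eq_integral do rewrite big_nil; rewrite integral0 big_nil.
have [|ir Ir] := IH; first by move=> p' p'r; apply: mr; rewrite inE p'r orbT.
have mp : measurable p.2 by apply: mr; exact: mem_head.
have ip : nu.-integrable setT (fun x => (p.1 * \1_(p.2) x)%:E).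
  apply: (@bounded_integrable _ _ _ _ _ `|p.1|).
    by apply: measurable_funM => //; exact: measurable_indic.
  move=> x; rewrite normrM ler_piMr// indicE.
  by case: (_ \in _); rewrite ?normr1 ?normr0.
have E x : (simple_comb (p :: r) x)%:E =
    ((p.1 * \1_(p.2) x)%:E + (simple_comb r x)%:E)%E.
  by rewrite /simple_comb big_cons.
split.
  rewrite (_ : _ \o _ = fun x => (p.1 * \1_(p.2) x)%:E + (simple_comb r x)%:E)%E.
    exact: integrableD.
  by apply/funext => x; exact: E.
under eq_integral do rewrite E.
rewrite integralD// Ir big_cons EFinD; congr (_ + _)%E.
under eq_integral do rewrite EFinM.
rewrite integralZl//; last first.
  apply: (@bounded_integrable _ _ _ _ _ 1); first exact: measurable_indic.
  by move=> x; rewrite indicE; case: (_ \in _); rewrite ?normr1 ?normr0.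
by rewrite integral_indic// setIT EFinM fineK// fin_num_measure.
Qed.

End SimpleComb.

Section EntropyBound.
Variables (K : fieldExtType rat) (b : nat -> idealr (OK K)) (R : realType).
Hypothesis fin_quot : forall l, finite_set [set: {ideal_quot (b l)}].
Variables (P : probability (borel (phase_group b)) R) (hP : is_haar P).
Variables (nu : probability (borel (config K)) R).
Hypotheses (hnuS : shift_invariant nu) (hnuY : nu (Y b) = 1%E)
  (hnuP : forall A, measurable A -> pushforward nu (@theta K b) A = P A).
Implicit Types (x : borel (config K)) (E W A F : {fset OK K}).

(** The sites where the phase of [x] permits a 1. *)
Definition phi x : borel (config K) := varphi (theta b x).

Definition covers E : set (borel (config K)) := [set x | forall c, c \in E -> x c].

Lemma measurable_covers E : measurable (covers E).
Proof.
apply: measurable_forall => [|c]; first exact: countable_OK.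
by apply: measurable_imply; [exact: measurable_constP|exact: measurable_config_coord].
Qed.

Lemma measurable_phi : measurable_fun setT phi.
Proof.
by apply: measurableT_comp; [exact: measurable_varphi|exact: measurable_theta].
Qed.

Lemma ae_Y : {ae nu, forall x, Y b x}.
Proof.
exists (~` Y b); split; last by [].
- by apply: measurableC; exact: measurable_Y.
- by rewrite probability_setC ?hnuY ?subee//; exact: measurable_Y.
Qed.

Definition shift_covers E t : set (borel (config K)) := shift_map t @^-1` covers E.

Lemma measurable_shift_covers E t : measurable (shift_covers E t).
Proof.
by apply: measurable_preimageT; [exact: measurable_shift_map|exact: measurable_covers].
Qed.

Lemma nu_phi B : measurable B -> nu (phi @^-1` B) = P (varphi (b := b) @^-1` B).
Proof.
move=> mB; rewrite -hnuP//; apply: measurable_preimageT => //.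
exact: measurable_varphi.
Qed.

Lemma nu_phi_coord a : nu [set x | phi x a] = (density b R)%:E.
Proof.
by rewrite -(haar_varphi fin_quot hP a) (nu_phi (measurable_config_coord a)).
Qed.

Lemma nu_shift_covers E t : nu (shift_covers E t) = nu (covers E).
Proof. by rewrite hnuS//; exact: measurable_covers. Qed.

Lemma nu_phi_shift_covers E t : nu (phi @^-1` shift_covers E t) =
  P (varphi (b := b) @^-1` covers E).
Proof.
by rewrite nu_phi ?(haar_varphi_translate hP)//; exact: measurable_shift_covers.
Qed.

(** The subtracted product is the [kappa]-measure of [covers E], as [kappa_covers] shows; the bias
    measures how far [nu] deviates from [kappa] on this event. *)
Definition bias E : R :=
  fine (nu (covers E)) - 2^-1 ^+ #|` E| * fine (P (varphi (b := b) @^-1` covers E)).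

End EntropyBound.

Section Restriction.
Variables (K : fieldExtType rat) (A : {fset OK K}).
Implicit Types (x : borel (config K)) (w : {ffun A -> bool}).

Definition restr x : {ffun A -> bool} := [ffun a => x (val a)].

Definition extend w : borel (config K) := fun a => oapp w false (insub a).

Lemma extend_restr x a : a \in A -> extend (restr x) a = x a.
Proof. by move=> aA; rewrite /extend insubT/= ffunE. Qed.

Definition block (E : {fset OK K}) (t : OK K) : seq A :=
  pmap insub [seq t + c | c <- E].

Lemma block_uniq E t : uniq (block E t).
Proof.
by apply: pmap_sub_uniq; rewrite map_inj_uniq ?fset_uniq//; exact: addrI.
Qed.

Lemma prod_block (R : realType) E t (h : OK K -> R) :
  (forall c, c \in E -> t + c \in A) ->
  \prod_(a <- block E t) h (val a) = \prod_(c <- E) h (t + c).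
Proof.
move=> EA; rewrite -(big_map val xpredT h) /block pmap_filter; last exact: insubK.
rewrite (@eq_in_filter _ _ xpredT) ?filter_predT ?big_map//.
by move=> _ /mapP[c cE ->]; rewrite /= insubT// EA.
Qed.

End Restriction.

Lemma measurable_restr_varphi (K : fieldExtType rat) (b : nat -> idealr (OK K))
    (A : {fset OK K}) (s : {ffun A -> bool}) :
  measurable [set g | restr A (varphi (b := b) g) = s].
Proof.
rewrite (_ : [set g | _] = [set g | forall a : A, varphi (b := b) g (val a) = s a]).
  apply: measurable_forall => [|a]; first exact: countableP.
  case: (s a); first exact: measurable_varphi_coord.
  rewrite (_ : [set g | _] = [set g | ~ varphi (b := b) g (val a)]).
    by apply: measurable_not; exact: measurable_varphi_coord.
  by apply/seteqP; split => g /=; [move=> ->|move=> /negP/negbTE].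
apply/seteqP; split => g /=; first by move=> <- a; rewrite ffunE.
by move=> gs; apply/ffunP => a; rewrite ffunE; exact: gs.
Qed.

Lemma F_theta_restr (K : fieldExtType rat) (b : nat -> idealr (OK K))
    (A : {fset OK K}) (s : {ffun A -> bool}) :
  F_theta b ((fun x => restr A (phi b x)) @^-1` [set s]).
Proof.
by exists [set g | restr A (varphi (b := b) g) = s];
  [exact: measurable_restr_varphi|rewrite setTI].
Qed.

Section IndicatorProduct.
Context {R : realType} {I : choiceType}.

Lemma prod_bool_all (r : seq I) (h : I -> bool) :
  \prod_(c <- r) (h c)%:R = (all h r)%:R :> R.
Proof.
elim: r => [|c r IH]; first by rewrite big_nil.
by rewrite big_cons IH /=; case: (h c); rewrite ?mul1r ?mul0r.
Qed.

Lemma prod_coin_true (r : seq I) (h : I -> bool) :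
  \prod_(c <- r) coin (h c) true = 2^-1 ^+ size r * (all h r)%:R :> R.
Proof.
elim: r => [|c r IH]; first by rewrite big_nil expr0 mulr1.
rewrite big_cons IH /= exprS /coin; case: (h c) => /=; first by rewrite mulrA.
by rewrite mul0r mulr0.
Qed.

End IndicatorProduct.

(** [ln1D_ge] at [eta * (u - c * v)], whose square is at most [eta ^+ 2]. The bound is affine in [u]
    and [v]; for indicators it integrates to the gain from the bias and a quadratic loss. *)
Lemma Nlog2_1D_le (R : realType) (eta c u v : R) : `|eta| <= 2^-1 ->
  0 <= c <= 1 -> 0 <= u <= 1 -> 0 <= v <= 1 ->
  - log2 (1 + eta * (u - c * v)) <=
  - (eta / ln 2) * u + eta * c / ln 2 * v + 2 * eta ^+ 2 / ln 2.
Proof.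
move=> eta_le /andP[c0 c1] /andP[u0 u1] /andP[v0 v1].
have cv0 : 0 <= c * v by exact: mulr_ge0.
have cv1 : c * v <= 1 by rewrite -[leRHS]mulr1 ler_pM.
set z := u - c * v.
have z1 : `|z| <= 1 by rewrite ler_norml /z; apply/andP; split; lra.
have y1 : `|eta * z| <= 2^-1 by rewrite normrM -[leRHS]mulr1 ler_pM.
have z2 : z ^+ 2 <= 1 by rewrite -[z ^+ 2]ger0_norm ?sqr_ge0// normrX exprn_ile1.
have y2 : (eta * z) ^+ 2 <= eta ^+ 2 by rewrite exprMn ler_piMr ?sqr_ge0.
have H : - ln (1 + eta * z) <= 2 * eta ^+ 2 - eta * z.
  by have := ln1D_ge y1; lra.
have -> : - (eta / ln 2) * u + eta * c / ln 2 * v + 2 * eta ^+ 2 / ln 2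
  = (2 * eta ^+ 2 - eta * z) / ln 2 by rewrite /z; ring.
by rewrite /log2 -mulNr ler_pM2r ?invr_gt0 ?ln2_gt0.
Qed.

Lemma block_factor_gt0 (R : realType) (T : finType) (s : T -> bool) (eta : R)
    (r : seq T) (w : {ffun T -> bool}) :
  `|eta| <= 2^-1 -> 0 < block_factor s eta r w.
Proof.
move=> eta_le; rewrite /block_factor.
have p1 : 0 <= (\prod_(a <- r) (w a)%:R : R) <= 1.
  rewrite prodr_ge0//=; apply: prodr_ile1 => a _.
  by case: (w a); rewrite ?lexx ler01.
have p2 : 0 <= (\prod_(a <- r) coin (s a) true : R) <= 1.
  rewrite prodr_ge0 => [|a _]; last exact: coin_ge0.
  apply: prodr_ile1 => a _; rewrite coin_ge0/=.
  by have := coin_sum (R := R) (s a); have := coin_ge0 (R := R) (s a) false; lra.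
move: p1 p2; set u := \prod_(a <- r) _; set v := \prod_(a <- r) _.
move=> /andP[u0 u1] /andP[v0 v1].
have z1 : `|u - v| <= 1 by rewrite ler_norml; apply/andP; split; lra.
have : `|eta * (u - v)| <= 2^-1 by rewrite normrM -[leRHS]mulr1 ler_pM.
by rewrite ler_norml => /andP[]; lra.
Qed.

(** * Entropy of a partition on one finite window *)

Section CodeBound.
Variables (K : fieldExtType rat) (b : nat -> idealr (OK K)) (R : realType).
Hypothesis fin_quot : forall l, finite_set [set: {ideal_quot (b l)}].
Variables (P : probability (borel (phase_group b)) R) (hP : is_haar P).
Variables (nu : probability (borel (config K)) R).
Hypotheses (hnuS : shift_invariant nu) (hnuY : nu (Y b) = 1%E)
  (hnuP : forall A, measurable A -> pushforward nu (@theta K b) A = P A).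
Implicit Types (x : borel (config K)).
Local Notation phi := (phi b).

Variables (k : nat) (idx idx' : borel (config K) -> 'I_k).
Hypotheses (midx : forall i, measurable (idx @^-1` [set i]))
  (midx' : forall i, measurable (idx' @^-1` [set i])).
Variables (W E F A : {fset OK K}) (M : seq (OK K)) (eta delta : R).
Hypothesis idx'W : forall x y : borel (config K),
  (forall c, c \in W -> x c = y c) -> idx' x = idx' y.
Hypothesis FWA : forall a c, a \in F -> c \in W -> a + c \in A.
Hypothesis MEA : forall t c, t \in M -> c \in E -> t + c \in A.
Hypothesis M_disj : pairwise (fun t u =>
  ~~ has (mem [seq t + c | c <- E]) [seq u + c | c <- E]) M.
Hypotheses (eta_le : `|eta| <= 2^-1) (delta_gt0 : 0 < delta) (delta_lt1 : delta < 1).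

(* Law of the symbol [i] of the partition given its finite-window guess [j]. *)
Definition kern (i j : 'I_k) : R := if i == j then 1 - delta else delta / k%:R.

Let k_gt0 : (0 < k)%N.
Proof. exact: leq_ltn_trans (leq0n _) (ltn_ord (idx point)). Qed.

Lemma kern_gt0 i j : 0 < kern i j.
Proof. by rewrite /kern; case: ifP; rewrite ?subr_gt0// divr_gt0// ltr0n. Qed.

Lemma sum_kern j : \sum_i kern i j <= 1.
Proof.
rewrite (bigD1 j)//= {1}/kern eqxx.
rewrite (eq_bigr (fun=> delta / k%:R)) => [|i ij]; last by rewrite /kern (negbTE ij).
rewrite sumr_const -[_ *+ #|_|]mulr_natr -mulrA [_^-1 * _]mulrC.
apply: (@le_trans _ _ (1 - delta + delta * 1)); last by rewrite mulr1 subrK.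
rewrite lerD2l ler_pM2l// ler_pdivrMr ?ltr0n// mul1r ler_nat.
by rewrite -[X in (_ <= X)%N](card_ord k); exact: max_card.
Qed.

Let names x : {ffun F -> 'I_k} := [ffun a => idx (shift_map (val a) x)].

Let err : set (borel (config K)) := [set x | idx x <> idx' x].

(** Joint weight of a name [c] and a candidate window [w]: the tilted coin weight of [w] times the
    kernel from the guesses made on [w] to the symbols of [c]. Summing out [w] gives a code for
    names. *)
Let code_term (c : {ffun F -> 'I_k}) (s w : {ffun A -> bool}) : R :=
  coin_weight s w * \prod_(r <- [seq block A E t | t <- M]) block_factor s eta r w *
  \prod_(a : F) kern (c a) (idx' (shift_map (val a) (extend w))).

Let code (c : {ffun F -> 'I_k}) (s : {ffun A -> bool}) : R := \sum_w code_term c s w.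

Let code_term_ge0 c s w : 0 <= code_term c s w.
Proof.
rewrite /code_term !mulr_ge0 ?coin_weight_ge0 ?prodr_ge0// => ? _.
  exact/ltW/block_factor_gt0/eta_le.
exact/ltW/kern_gt0.
Qed.

(** For a fixed window the kernels sum to at most 1 over all names; the tilted weights of the
    windows then sum to 1 because the blocks are disjoint. *)
Let sum_code s : \sum_c code c s <= 1.
Proof.
rewrite /code exchange_big/=.
rewrite -(@sum_block_code R _ s eta [seq block A E t | t <- M]).
- apply: ler_sum => w _; rewrite /code_term -mulr_sumr ler_piMr//.
    rewrite mulr_ge0 ?coin_weight_ge0 ?prodr_ge0// => r _.
    exact/ltW/block_factor_gt0/eta_le.
  rewrite -(bigA_distr_bigA (fun a i => kern i (idx' (shift_map (val a) (extend w)))))/=.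
  apply: prodr_ile1 => a _; rewrite sum_kern sumr_ge0// => i _.
  exact/ltW/kern_gt0.
- by move=> _ /mapP[t _ ->]; exact: block_uniq.
- rewrite pairwise_map; apply: sub_pairwise M_disj => t u /=.
  apply: contra => /hasP[a]; rewrite /block mem_pmap_sub => au at_.
  apply/hasP; exists (val a) => //=.
  by have : a \in block A E t by []; rewrite mem_pmap_sub.
Qed.

Let blkval x t : R := \1_(shift_covers E t) x
  - 2^-1 ^+ #|` E| * \1_(phi @^-1` shift_covers E t) x.

Let block_factorE x t : t \in M ->
  block_factor (restr A (phi x)) eta (block A E t) (restr A x) = 1 + eta * blkval x t.
Proof.
move=> tM; have EA c : c \in E -> t + c \in A by exact: MEA.
have coversE y : \1_(shift_covers E t) y = (all (fun c => y (t + c)) E)%:R :> R.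
  rewrite indicE; congr (nat_of_bool _)%:R; apply/idP/allP => [/set_mem//|yE].
  exact/mem_set.
have -> : blkval x t = \1_(shift_covers E t) x
  - 2^-1 ^+ #|` E| * \1_(shift_covers E t) (phi x) by [].
rewrite !coversE /block_factor; congr (1 + eta * (_ - _)).
  under eq_bigr do rewrite ffunE.
  by rewrite (prod_block (fun a => (x a)%:R) EA) prod_bool_all.
under eq_bigr do rewrite ffunE.
by rewrite (prod_block (fun a => coin (phi x a) true) EA) prod_coin_true.
Qed.

Let measurable_err : measurable err.
Proof. exact: measurable_neq_fintype. Qed.

(** Bound on the code length, in order: one bit per allowed site of [A]; the linear part of the tilt
    in two sums; the quadratic part together with the base price of each guess; the surcharge for
    wrong guesses. *)
Let L : seq (R * set (borel (config K))) :=
  [seq (1, [set x | phi x a]) | a <- A] ++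
  [seq (- (eta / ln 2), shift_covers E t) | t <- M] ++
  [seq (eta * 2^-1 ^+ #|` E| / ln 2, phi @^-1` shift_covers E t) | t <- M] ++
  [:: ((size M)%:R * (2 * eta ^+ 2 / ln 2) - #|` F|%:R * log2 (1 - delta), setT)] ++
  [seq (- log2 (delta / k%:R), shift_map a @^-1` err) | a <- F].

Let measurable_L p : p \in L -> measurable p.2.
Proof.
rewrite !mem_cat inE => /or4P[||| /orP[]].
- move=> /mapP[a _ ->]; apply: (@measurable_preimageT _ _ _ _ phi [set x | x a]).
    exact: measurable_phi.
  exact: measurable_config_coord.
- by move=> /mapP[t _ ->]; exact: measurable_shift_covers.
- move=> /mapP[t _ ->]; apply: measurable_preimageT; first exact: measurable_phi.
  exact: measurable_shift_covers.
- by move=> /eqP ->; exact: measurableT.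
- move=> /mapP[a _ ->]; apply: measurable_preimageT; first exact: measurable_shift_map.
  exact: measurable_err.
Qed.

Let log2_block x t :
  - log2 (1 + eta * blkval x t) <= - (eta / ln 2) * \1_(shift_covers E t) x
    + eta * 2^-1 ^+ #|` E| / ln 2 * \1_(phi @^-1` shift_covers E t) x
    + 2 * eta ^+ 2 / ln 2.
Proof.
have b01 (B : set (borel (config K))) : 0 <= (\1_B x : R) <= 1.
  by rewrite indicE; case: (_ \in _); rewrite ?lexx ler01.
apply: Nlog2_1D_le => //.
by rewrite exprn_ge0 ?invr_ge0//= exprn_ile1 ?invr_ge0// invf_le1// ler1n.
Qed.

Let log2_kern i j : - log2 (kern i j) <=
  - log2 (1 - delta) - log2 (delta / k%:R) * (i != j)%:R.
Proof.
have l0 y : 0 < y <= 1 -> log2 y <= 0 :> R.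
  move=> /andP[y0 y1]; rewrite /log2 mulr_le0_ge0 ?ln_le0//.
  by rewrite invr_ge0 ltW// ln2_gt0.
rewrite /kern; case: eqP => _ /=; first by rewrite mulr0 subr0.
rewrite mulr1 lerDr oppr_ge0; apply: l0; rewrite subr_gt0 delta_lt1/=.
by rewrite lerBlDr lerDl ltW.
Qed.

(** On [Y] the true window respects the phase, so its coin weight is exactly one factor of one half
    per allowed site. The code is at least its term at that window, and the logarithm of the product
    splits into the groups of [L]. *)
Let log2_code x : Y b x ->
  0 < code (names x) (restr A (phi x)) /\
  - log2 (code (names x) (restr A (phi x))) <= simple_comb L x.
Proof.
move=> Yx; set c := names x; set s := restr A (phi x); pose w := restr A x.
have ws a : w a -> s a by rewrite !ffunE; exact: le_varphi_theta.
have wt_gt0 : 0 < coin_weight (R := R) s w.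
  by rewrite coin_weightE// exprn_gt0// invr_gt0.
have term_gt0 : 0 < code_term c s w.
  rewrite /code_term !mulr_gt0// prodr_gt0// => *;
    first exact: (block_factor_gt0 _ _ _ eta_le).
  exact: kern_gt0.
have code_ge : code_term c s w <= code c s.
  by rewrite /code (bigD1 w)//= lerDl sumr_ge0.
split; first exact: lt_le_trans code_ge.
apply: (@le_trans _ _ (- log2 (code_term c s w))).
  by rewrite lerN2; exact: log2_gt0_le.
have log2M (u v : R) : 0 < u -> 0 < v -> log2 (u * v) = log2 u + log2 v.
  by move=> u0 v0; rewrite /log2 lnM ?posrE// mulrDl.
have blk_gt0 : 0 < \prod_(r <- [seq block A E t | t <- M]) block_factor s eta r w.
  by apply: prodr_gt0 => r _; exact: (block_factor_gt0 _ _ _ eta_le).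
have kern_gt0' : 0 < \prod_(a : F) kern (c a) (idx' (shift_map (val a) (extend w))).
  by apply: prodr_gt0 => a _; exact: kern_gt0.
rewrite /code_term log2M// ?mulr_gt0// log2M// !opprD.
rewrite /simple_comb !big_cat/= !big_map/= !addrA.
rewrite -!addrA lerD//.
  rewrite coin_weightE// log2_invX opprK big_seq_fsetE/= -sum1_card natr_sum big_mkcond/=.
  apply: ler_sum => a _; rewrite mul1r indicE.
  have -> : (a \in [pred a0 | s a0]) = phi x (fsval a) by rewrite inE /s ffunE.
  by case: ifPn => px; [rewrite mem_set|rewrite ler0n].
have H1 : - log2 (\prod_(j <- M) block_factor s eta (block A E j) w) <=
    \sum_(j <- M) - (eta / ln 2) * \1_(shift_covers E j) x +
    \sum_(j <- M) eta * 2^-1 ^+ #|` E| / ln 2 * \1_(phi @^-1` shift_covers E j) x +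
    (size M)%:R * (2 * eta ^+ 2 / ln 2).
  rewrite log2_prod => [|j]; last exact: (block_factor_gt0 _ _ _ eta_le).
  have -> : (size M)%:R * (2 * eta ^+ 2 / ln 2) =
      \sum_(j <- M) (2 * eta ^+ 2 / ln 2) :> R.
    by rewrite big_const_seq count_predT iter_addr addr0 mulr_natl.
  rewrite -sumrN -!big_split/= [leLHS]big_seq [leRHS]big_seq.
  by apply: ler_sum => j jM; rewrite block_factorE//; exact: log2_block.
have H2 : - log2 (\prod_a kern (c a) (idx' (shift_map (fsval a) (extend w)))) <=
    - (#|` F|%:R * log2 (1 - delta)) +
    \sum_(j <- F) - log2 (delta / k%:R) * \1_(shift_map j @^-1` err) x.
  rewrite log2_prod => [|j]; last exact: kern_gt0.
  have -> : #|` F|%:R * log2 (1 - delta) = \sum_(j <- F) log2 (1 - delta) :> R.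
    by rewrite big_const_seq count_predT iter_addr addr0 mulr_natl.
  rewrite -!sumrN -big_split/= big_seq_fsetE/=.
  apply: ler_sum => a _.
  have -> : idx' (shift_map (fsval a) (extend w)) = idx' (shift_map (fsval a) x).
    apply: idx'W => e eW; rewrite /shift_map /w extend_restr//.
    by apply: FWA => //; exact: fsvalP.
  apply: le_trans (log2_kern _ _) _; rewrite mulNr /c ffunE indicE.
  rewrite (_ : (x \in _) =
    (idx (shift_map (fsval a) x) != idx' (shift_map (fsval a) x)))//.
  by apply/idP/idP => [/set_mem/eqP//|/eqP e]; exact/mem_set.
rewrite big_seq1/= indicE mem_set// mulr1; lra.
Qed.

(** Integration of [log2_code]. By invariance the integral of each group of [L] is a cardinality
    times one fixed number, so every translate in [M] yields the same gain. *)
Lemma entropy_bound :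
  (cond_entropy nu (F_theta b)
     (@join_partition _ _ _ (@shift_map K) F _ (fun i => idx @^-1` [set i])) <=
   (#|` A|%:R * density b R
    - (size M)%:R * ((eta * bias P nu E - 2 * eta ^+ 2) / ln 2)
    + #|` F|%:R * (- log2 (1 - delta) - fine (nu err) * log2 (delta / k%:R)))%:E)%E.
Proof.
have [intL IL] := integral_simple_comb nu measurable_L.
have -> : @join_partition _ _ _ (@shift_map K) F _ (fun i => idx @^-1` [set i]) =
    (fun c => names @^-1` [set c]).
  apply/funext => c; apply/seteqP; split => x /=.
    by move=> xc; apply/ffunP => a; rewrite ffunE xc.
  by move=> <- a; rewrite ffunE.
apply: (@le_trans _ _ (\int[nu]_x (simple_comb L x)%:E)%E).
  apply: (@cond_entropy_le_code _ _ _ _ _ (sigma_algebra_F_theta b)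
    (F_theta_measurable fin_quot) _ _ names (fun x => restr A (phi x)) code) => //.
  - move=> c; rewrite (_ : _ @^-1` _ =
        [set x | forall a : F, idx (shift_map (val a) x) = c a]).
      apply: measurable_forall => [|a]; first exact: countableP.
      exact: (measurable_preimageT (measurable_shift_map _) (midx (c a))).
    apply/seteqP; split => x /=.
      by move=> <- a; rewrite ffunE.
    by move=> xc; apply/ffunP => a; rewrite ffunE xc.
  - exact: F_theta_restr.
  - by move=> c s; apply: sumr_ge0.
  - by apply: filterS (ae_Y fin_quot hnuY) => x; exact: log2_code.
rewrite IL lee_fin !big_cat/= !big_map big_seq1/=.
have sum_cst (I : Type) (r : seq I) (u : R) : \sum_(i <- r) u = (size r)%:R * u.
  by rewrite big_const_seq count_predT iter_addr addr0 mulr_natl.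
under eq_bigr do rewrite (nu_phi_coord fin_quot hP hnuP).
under [X in _ + (X + _)]eq_bigr do rewrite nu_shift_covers//.
under [X in _ + (_ + (X + _))]eq_bigr do
  rewrite (nu_phi_shift_covers hP hnuP).
under [X in _ + (_ + (_ + (_ + X)))]eq_bigr do rewrite hnuS//.
rewrite !sum_cst probability_setT /bias /=.
move: (fine (nu (covers E))) (fine (P _)) (fine (nu err)) (density b R).
move: (log2 (1 - delta)) (log2 (delta / _)) (2^-1 ^+ _) (ln 2).
move: (size A)%:R (size M)%:R (size F)%:R => nA nM nF l1 l2 c l u v e D.
clear; rewrite le_eqVlt; apply/orP; left; apply/eqP.
ring.
Qed.

End CodeBound.

(** * Finite-window approximation of partitions *)

Section Approximation.
Variables (K : fieldExtType rat) (R : realType).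
Variable nu : probability (borel (config K)) R.
Implicit Types (A C : set (borel (config K))) (W : {fset OK K}).

Definition window W A :=
  forall x y : borel (config K), (forall c, c \in W -> x c = y c) -> A x -> A y.

Definition symdiff A C : set (borel (config K)) := (A `\` C) `|` (C `\` A).

Definition approximable A := measurable A /\ forall e : R, 0 < e ->
  exists W C, [/\ measurable C, window W C & (nu (symdiff A C) <= e%:E)%E].

Lemma measurable_symdiff A C : measurable A -> measurable C -> measurable (symdiff A C).
Proof. by move=> mA mC; apply: measurableU; exact: measurableD. Qed.

Lemma approximableC A : approximable A -> approximable (~` A).
Proof.
move=> [mA aA]; split; first exact: measurableC.
move=> e /aA[W [C [mC WC le]]]; exists W, (~` C); split.
- exact: measurableC.
- by move=> x y xy Cx Cy; apply: Cx; apply: WC Cy => c cW; rewrite xy.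
- by rewrite /symdiff !setDE !setCK setUC [_ `&` A]setIC [_ `&` C]setIC -!setDE.
Qed.

Lemma approximableU A A' : approximable A -> approximable A' -> approximable (A `|` A').
Proof.
move=> [mA aA] [mA' aA']; split; first exact: measurableU.
move=> e e0; have e20 : 0 < e / 2 by lra.
have [W [C [mC WC le]]] := aA _ e20; have [W' [C' [mC' WC' le']]] := aA' _ e20.
exists (W `|` W')%fset, (C `|` C'); split.
- exact: measurableU.
- move=> x y xy [Cx|Cx]; [left; apply: WC Cx|right; apply: WC' Cx] => c cW;
    by apply: xy; rewrite inE cW ?orbT.
- apply: (@le_trans _ _ (nu (symdiff A C `|` symdiff A' C'))).
    apply: le_measure; rewrite ?inE.
    + by apply: measurable_symdiff; exact: measurableU.
    + by apply: measurableU; exact: measurable_symdiff.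
    + by move=> x; rewrite /symdiff /=; tauto.
  apply: le_trans (measureU2 _ _ _) _ => //=; [exact: measurable_symdiff..|].
  by rewrite [e]splitr EFinD leeD.
Qed.

Lemma approximable0 : approximable set0.
Proof.
split; first exact: measurable0.
move=> e e0; exists fset0, set0; split => //.
by rewrite /symdiff setDv setU0 measure0 lee_fin ltW.
Qed.

(** Countable unions are the substantial case: by continuity of [nu] from above a finite partial
    union misses at most [e / 2], and finite unions are already approximable. *)
Lemma approximable_sigma_algebra : sigma_algebra setT approximable.
Proof.
split; [exact: approximable0|by move=> A /approximableC; rewrite setTD|].
move=> A aA; have mA i : measurable (A i) by case: (aA i).
have mUA : measurable (\bigcup_i A i) by exact: bigcupT_measurable.
split=> // e e0.
have e20 : 0 < e / 2 by lra.
pose U n := \big[setU/set0]_(i < n.+1) A i.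
have aU n : approximable (U n).
  rewrite /U; elim/big_ind: _ => //; first exact: approximable0.
  exact: approximableU.
have mU n : measurable (U n) by case: (aU n).
have UA n : U n `<=` \bigcup_i A i by exact: bigsetU_bigcup.
pose V n := (\bigcup_i A i) `\` U n.
have mV n : measurable (V n) by exact: measurableD.
have V0 : \bigcap_n V n = set0.
  apply/seteqP; split => // x Vx; have [[i _ Aix] _] := Vx 0%N Logic.I.
  by have [_ []] := Vx i Logic.I; rewrite /U big_ord_recr/=; right.
have cV : (nu \o V) n @[n --> \oo] --> nu (\bigcap_n V n).
  apply: nonincreasing_cvg_mu => //.
  - by rewrite ltey_eq fin_num_measure.
  - exact: bigcapT_measurable.
  - by move=> m n mn; apply/subsetPset; apply: setDS; exact: subset_bigsetU.
have [n nVn] : exists n, (nu (V n) <= (e / 2)%:E)%E.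
  move: cV; rewrite V0 measure0 => /fine_cvgP[_ /cvgrPdist_lt /(_ _ e20)].
  move=> [n _ /(_ n (leqnn n))/=]; rewrite sub0r normrN => nVn; exists n.
  rewrite -(@fineK _ (nu (V n))) ?fin_num_measure// lee_fin.
  exact: le_trans (ler_norm _) (ltW nVn).
have [_ /(_ _ e20)[W [C [mC WC le]]]] := aU n.
exists W, C; split => //.
apply: (@le_trans _ _ (nu (V n `|` symdiff (U n) C))).
  apply: le_measure; rewrite ?inE.
  + exact: measurable_symdiff.
  + by apply: measurableU; [exact: mV|exact: measurable_symdiff].
  + move=> x; rewrite /symdiff /V /=; have := @UA n x; have := EM (U n x).
    by rewrite /=; tauto.
apply: le_trans (measureU2 _ _ _) _ => //=.
- exact: measurable_symdiff.
- by rewrite [e]splitr EFinD leeD.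
Qed.

(** The identity from the measurable space whose events are the approximable sets has measurable
    coordinates, so open sets are approximable, and then all Borel sets. *)
Lemma measurable_approximable A : measurable A -> approximable A.
Proof.
have sA := approximable_sigma_algebra.
have mopen : @open (config K) `<=` approximable.
  move=> U oU; apply/(measurable_subsigma _ sA).
  apply: (@measurable_preimage_open _ _ _ (@OK_code_inj K) _
    (g_sigma_algebraType approximable) id) oU => [a c|a]; last exact: countableP.
  apply/(measurable_subsigma _ sA).
  have aa : approximable [set x | x a].
    split; first exact: measurable_config_coord.
    move=> e e0; exists [fset a]%fset, [set x | x a]; split.
    - exact: measurable_config_coord.
    - by move=> x y xy /=; rewrite xy// inE.
    - by rewrite /symdiff setDv setU0 measure0 lee_fin ltW.
  case: c; first exact: aa.
  rewrite (_ : [set t | _] = ~` [set x : borel (config K) | x a]).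
    exact: approximableC.
  by apply/seteqP; split => x /=; [move=> -> | case: (x a)].
by apply: smallest_sub.
Qed.

(** Each cell is approximated within [e / k] by a window set [C i], and [idx'] picks an [i] with
    [C i x], or a default symbol if there is none. Outside the [k] symmetric differences exactly one
    [C i] contains [x], and the guess is right. *)
Lemma partition_approx (k : nat) (idx : borel (config K) -> 'I_k) (e : R) :
  (forall i, measurable (idx @^-1` [set i])) -> 0 < e ->
  exists W (idx' : borel (config K) -> 'I_k),
    [/\ forall x y : borel (config K),
          (forall c, c \in W -> x c = y c) -> idx' x = idx' y,
        forall i, measurable (idx' @^-1` [set i])
      & fine (nu [set x | idx x <> idx' x]) <= e].
Proof.
move=> midx e0.
have k0 : (0 < k)%N by exact: leq_ltn_trans (leq0n _) (ltn_ord (idx point)).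
have ek0 : 0 < e / k%:R by rewrite divr_gt0// ltr0n.
have /choice[W /choice[C CP]] : forall i, exists W C,
    [/\ measurable C, window W C
      & (nu (symdiff (idx @^-1` [set i]) C) <= (e / k%:R)%:E)%E].
  by move=> i; have [_ /(_ _ ek0)] := measurable_approximable (midx i).
have mC i : measurable (C i) by have [] := CP i.
pose v x : {ffun 'I_k -> bool} := [ffun i => `[< C i x >]].
pose g (u : {ffun 'I_k -> bool}) : 'I_k := odflt (Ordinal k0) [pick i | u i].
have mv u : measurable (v @^-1` [set u]).
  rewrite (_ : _ @^-1` _ = [set x | forall i, `[< C i x >] = u i]).
    apply: measurable_forall => [|i]; first exact: countableP.
    case: (u i).
      rewrite (_ : [set x | _] = C i)//.
      by apply/seteqP; split => x /= => [/asboolP//|Cx]; exact/asboolP.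
    rewrite (_ : [set x | _] = ~` C i); first exact: measurableC.
    by apply/seteqP; split => x /= => [/asboolPn//|Cx]; apply/negbTE/asboolPn.
  apply/seteqP; split => x /=.
    by move=> <- i; rewrite ffunE.
  by move=> xu; apply/ffunP => i; rewrite ffunE.
have midx' := measurable_preimage_fintype g mv.
exists (\big[@fsetU (OK K)/fset0]_(i : 'I_k) W i), (g \o v); split => //.
  move=> x y xy; rewrite /comp; congr g; apply/ffunP => i; rewrite !ffunE.
  have xyi c : c \in W i -> x c = y c.
    by move=> cW; apply: xy; apply/bigfcupP; exists i => //; rewrite mem_index_enum.
  have [_ WC _] := CP i.
  apply/asboolP/asboolP; apply: WC => // c cW; exact/esym/xyi.
have merr := measurable_neq_fintype midx midx'.
rewrite -lee_fin fineK ?fin_num_measure//.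
apply: (@le_trans _ _ (\sum_(i \in [set: 'I_k])
    nu (symdiff (idx @^-1` [set i]) (C i)))%E).
  apply: content_sub_fsum => //.
  - exact: finite_finset.
  - by move=> i _; exact: measurable_symdiff.
  - move=> x /= xerr; apply: contrapT => xC; apply: xerr.
    have CE i : C i x <-> idx x = i.
      split=> [Cix|xi]; apply: contrapT => H; apply: xC; exists i => //.
        by right.
      by left.
    rewrite /g; case: pickP => [i|/(_ (idx x))]; rewrite /v ffunE.
      by move=> /asboolP/CE.
    by move=> /asboolPn; case; apply/CE.
rewrite fsbig_finite//=.
apply: (@le_trans _ _ (\sum_(i <- fset_set [set: 'I_k]) (e / k%:R)%:E)%E).
  by apply: lee_sum => i _; have [] := CP i.
have sz : size (fset_set [set: 'I_k]) = k.
  have -> : fset_set [set: 'I_k] = [fset i | i in 'I_k]%fset.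
    apply/fsetP => i; rewrite in_fset_set; last exact: finite_finset.
    by rewrite mem_setT !inE.
  by rewrite -/(#|` _ |) card_finset card_ord.
rewrite sumEFin lee_fin big_const_seq count_predT iter_addr addr0 sz.
by rewrite -[_ *+ k]mulr_natr divfK// pnatr_eq0 -lt0n.
Qed.

End Approximation.

(** * Packings and Folner sets *)

Section Packing.
Variable V : zmodType.
Implicit Types E F W : {fset V}.

Definition disjoint_translates E (t u : V) :=
  ~~ has (mem [seq t + c | c <- E]) [seq u + c | c <- E].

(* [0] makes each translate cover itself, also when [E] is empty. *)
Definition spread E : seq V := 0 :: [seq c - c' | c <- E, c' <- E].

(** Greedy selection: if the translate by [s] meets a chosen one, then [s + c = t + c'] for some
    [c], [c'] in [E], so [s] lies in [t] plus a difference of [E]. *)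
Lemma packing E (r : seq V) : exists M : seq V,
  [/\ {subset M <= r}, pairwise (disjoint_translates E) M
    & {subset r <= [seq t + d | t <- M, d <- spread E]}].
Proof.
elim: r => [|s r [M [Mr M_disj rM]]]; first by exists [::].
have [/allP sM|] := boolP (all (disjoint_translates E s) M).
  exists (s :: M); split.
  - by move=> t; rewrite !inE => /predU1P[->|/Mr ->]; rewrite ?eqxx ?orbT.
  - by rewrite /= M_disj andbT; apply/allP.
  - move=> t; rewrite inE => /predU1P[->|/rM/allpairsP[[u d] [uM dE ->]]].
      by apply/allpairsP; exists (s, 0); rewrite /= !mem_head addr0.
    by apply: (allpairs_f (fun t d => t + d)) dE; rewrite inE uM orbT.
move=> /allPn[t tM]; rewrite negbK => /hasP[_ /mapP[c' c'E ->] /mapP[c cE e]].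
exists M; split=> // [u uM|u]; first by rewrite inE (Mr _ uM) orbT.
rewrite inE => /predU1P[->|/rM//].
apply/allpairsP; exists (t, c' - c); split => //=.
  by rewrite inE; apply/orP; right; apply/allpairsP; exists (c', c).
by rewrite addrA e addrK.
Qed.

Lemma packing_size E F : exists M : seq V,
  [/\ {subset M <= F}, pairwise (disjoint_translates E) M
    & (#|` F| <= size M * size (spread E))%N].
Proof.
have [M [MF M_disj FM]] := packing E F; exists M; split => //.
by rewrite -(size_allpairs (fun t d => t + d)); apply: uniq_leq_size.
Qed.

Definition thicken W F : {fset V} :=
  (F `|` \big[@fsetU V/fset0]_(w <- W) [fset (w + x)%R | x in F])%fset.

Lemma thicken_mem W F (a w : V) : a \in F -> w \in W -> a + w \in thicken W F.
Proof.
move=> aF wW; rewrite !inE; apply/orP; right.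
apply/bigfcupP; exists w; first by rewrite wW.
by rewrite addrC; apply/imfsetP; exists a.
Qed.

Lemma card_thicken W F : (#|` thicken W F| <= #|` F| +
  \sum_(w <- W) #|` (([fset (w + x)%R | x in F] `\` F) `|`
     (F `\` [fset (w + x)%R | x in F]))%fset|)%N.
Proof.
rewrite /thicken; elim: (enum_fset W) => [|w r IH].
  by rewrite !big_nil fsetU0 addn0.
rewrite !big_cons; set G := [fset (w + x)%R | x in F]%fset.
set U := \big[_/_]_(_ <- r) _ in IH *.
have -> : (F `|` (G `|` U) = (F `|` U) `|` (G `\` F))%fset.
  apply/fsetP => x; rewrite !inE; case: (x \in F) => //=.
  by rewrite orbC.
apply: leq_trans (leq_of_leqif (leq_card_fsetU _ _)) _.
rewrite addnCA [X in (_ <= X)%N]addnC leq_add//.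
by apply: fsubset_leq_card; exact: fsubsetUl.
Qed.

End Packing.

Section SmallCost.
Context {R : realType}.

(** [u] stands for the probability of a wrong guess. A single [delta] serves as kernel parameter and
    as tolerance, so it can be fixed before the approximating window is chosen. *)
Lemma code_cost_small (k : nat) (e : R) : (0 < k)%N -> 0 < e ->
  exists2 delta : R, 0 < delta < 1 & forall u, u <= delta ->
    - log2 (1 - delta) - u * log2 (delta / k%:R) <= e.
Proof.
move=> k0 e0; have kR : 0 < k%:R :> R by rewrite ltr0n.
have k4 : 0 < 4 + k%:R :> R by rewrite addr_gt0.
(* With [delta = r ^+ 2] the crude bound [- ln r <= r^-1] already controls the logarithm. In natural
   units the costs are at most [2 * r] for right guesses, [2 * r] for the logarithm of [delta] and
   [r * k%:R] for that of [k], hence the divisor [4 + k%:R]. *)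
pose r : R := Num.min 2^-1 (e * ln 2 / (4 + k%:R)).
have r0 : 0 < r.
  by rewrite lt_min invr_gt0 ltr0n/= divr_gt0 ?mulr_gt0 ?ln2_gt0.
have r2 : r <= 2^-1 by rewrite ge_min lexx.
have rE : r * (4 + k%:R) <= e * ln 2.
  by rewrite -ler_pdivlMr// ge_min lexx orbT.
have ln_inv (y : R) : 0 < y -> - ln y <= y^-1 - 1.
  move=> y0; rewrite -lnV ?posrE//.
  have := @le_ln1Dx R (y^-1 - 1); rewrite addrCA subrr addr0; apply.
  by rewrite ltrBrDl subrr invr_gt0.
have d0 : 0 < r ^+ 2 by rewrite exprn_gt0.
have dr : r ^+ 2 <= r * 2^-1 by rewrite expr2 ler_pM2l.
exists (r ^+ 2); first by rewrite d0/=; lra.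
move=> u ur.
have lnk : ln k%:R <= k%:R :> R.
  by have := ln_inv k%:R^-1; rewrite invr_gt0 invrK lnV ?posrE// opprK => /(_ kR); lra.
have lnr : - ln r <= r^-1 by have := ln_inv _ r0; lra.
have ln1 : - ln (1 - r ^+ 2) <= 2 * r.
  have d1 : 0 < 1 - r ^+ 2 by lra.
  apply: le_trans (ln_inv _ d1) _; rewrite lerBlDr -[leLHS]mul1r ler_pdivrMr//.
  nra.
have lndk : ln (r ^+ 2 / k%:R) = 2 * ln r - ln k%:R.
  by rewrite ln_div ?posrE// lnXn// mulr_natl.
have cost0 : 0 <= - ln (r ^+ 2 / k%:R).
  rewrite oppr_ge0 ln_le0// ler_pdivrMr// mul1r.
  by apply: le_trans (_ : 1 <= _); [lra|rewrite ler1n].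
rewrite -(@ler_pM2r _ (ln 2)) ?ln2_gt0// mulrBl mulNr /log2 mulfVK ?gt_eqF ?ln2_gt0//.
rewrite -mulrA mulfVK ?gt_eqF ?ln2_gt0//; apply: le_trans rE.
have H1 : - (u * ln (r ^+ 2 / k%:R)) <= r ^+ 2 * - ln (r ^+ 2 / k%:R).
  by rewrite -mulrN ler_wpM2r.
have H2 : r ^+ 2 * - ln (r ^+ 2 / k%:R) <= 2 * r + r * k%:R.
  rewrite lndk opprB mulrBr.
  have H3 : r ^+ 2 * - ln r <= r.
    apply: (@le_trans _ _ (r ^+ 2 * r^-1)); first by rewrite ler_pM2l.
    by rewrite expr2 mulfK// gt_eqF.
  have H4 : r ^+ 2 * ln k%:R <= r * k%:R.
    apply: (@le_trans _ _ (r ^+ 2 * k%:R)); first by rewrite ler_pM2l.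
    by rewrite ler_pM2r//; lra.
  lra.
lra.
Qed.

End SmallCost.

Section FolnerThicken.
Variables (V : zmodType) (R : realType) (F : nat -> {fset V}).
Hypothesis hF : folner R F.

Lemma folner_card_gt0 n : 0 < #|` F n|%:R :> R.
Proof. by rewrite ltr0n cardfs_gt0; case: hF. Qed.

Lemma folner_thicken (W : {fset V}) (e : R) : 0 < e ->
  \forall n \near \oo, #|` thicken W (F n)|%:R <= (1 + e) * #|` F n|%:R :> R.
Proof.
move=> e0; have [_ hF2] := hF.
pose D w n : {fset V} := (([fset (w + x)%R | x in F n] `\` F n) `|`
     (F n `\` [fset (w + x)%R | x in F n]))%fset.
have cD : (\sum_(w <- W) (#|` D w n|%:R / #|` F n|%:R : R)) @[n --> \oo] --> (0 : R).
  elim: (enum_fset W) => [|w s IH].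
    by under eq_fun do rewrite big_nil; exact: cvg_cst.
  under eq_fun do rewrite big_cons.
  by have := cvgD (hF2 w) IH; rewrite addr0; apply.
move/cvgrPdist_lt : cD => /(_ _ e0); apply: filterS => n.
rewrite sub0r normrN => /(le_lt_trans (ler_norm _))/ltW He.
apply: le_trans (_ : (#|` F n| + \sum_(w <- W) #|` D w n|)%:R <= _).
  by rewrite ler_nat; exact: card_thicken.
rewrite natrD mulrDl mul1r lerD2l -ler_pdivrMr ?folner_card_gt0//.
by rewrite natr_sum mulr_suml.
Qed.

End FolnerThicken.

(** * Upper bound along the Folner sequence *)

Section UpperBound.
Variables (K : fieldExtType rat) (b : nat -> idealr (OK K)) (R : realType).
Hypothesis fin_quot : forall l, finite_set [set: {ideal_quot (b l)}].
Variables (P : probability (borel (phase_group b)) R) (hP : is_haar P).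
Variables (nu : probability (borel (config K)) R).
Hypotheses (hnuS : shift_invariant nu) (hnuY : nu (Y b) = 1%E)
  (hnuP : forall A, measurable A -> pushforward nu (@theta K b) A = P A).
Variables (F : nat -> {fset OK K}) (hF : folner R F).
Local Notation D := (density b R).

Lemma measurable_join_partition (W : {fset OK K}) (I : finType)
    (Q : I -> set (borel (config K))) : (forall i, measurable (Q i)) ->
  forall c, measurable (@join_partition _ _ _ (@shift_map K) W I Q c).
Proof.
move=> mQ c; apply: measurable_forall => [|a]; first exact: countableP.
exact: (measurable_preimageT (measurable_shift_map _) (mQ (c a))).
Qed.

Lemma density_ge0 : 0 <= D.
Proof.
by rewrite -lee_fin -(haar_varphi fin_quot hP 0); exact: measure_ge0.
Qed.

(** Half of [e] pays for the guesses and half for the sites added when [F n] is thickened by [W] and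
    [E]. The packing has at least [#|F n| / size (spread E)] blocks, each saving [g] bits. *)
Lemma entropy_partition_near (k : nat) (idx : borel (config K) -> 'I_k)
    (E : {fset OK K}) (eta e : R) :
  let g := (eta * bias P nu E - 2 * eta ^+ 2) / ln 2 in
  (forall i, measurable (idx @^-1` [set i])) ->
  `|eta| <= 2^-1 -> 0 <= g -> 0 < e ->
  \forall n \near \oo, ((#|` F n|%:R^-1)%:E *
      cond_entropy nu (F_theta b)
        (@join_partition _ _ _ (@shift_map K) (F n) _ (fun i => idx @^-1` [set i]))
    <= (D - g / (size (spread E))%:R + e)%:E)%E.
Proof.
move=> g midx eta_le g0 e0.
have e20 : 0 < e / 2 by lra.
have k0 : (0 < k)%N by exact: leq_ltn_trans (leq0n _) (ltn_ord (idx point)).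
have [delta /andP[d0 d1] cost] := code_cost_small k0 e20.
have [W [idx' [idx'W midx' err]]] := partition_approx nu midx d0.
have {}cost := cost _ err.
have D1 : 0 < D + 1 by have := density_ge0; lra.
(* Dividing by [D + 1] instead of [D] also covers density 0. *)
have eD0 : 0 < e / 2 / (D + 1) by rewrite divr_gt0.
have := folner_thicken hF (W `|` E)%fset eD0.
apply: filterS => n card_A.
set A := thicken _ _ in card_A.
have Fn0 := folner_card_gt0 hF n.
have [M [MF M_disj FM]] := packing_size E (F n).
have FWA a c : a \in F n -> c \in W -> a + c \in A.
  by move=> aF cW; apply: thicken_mem => //; rewrite inE cW.
have MEA t c : t \in M -> c \in E -> t + c \in A.
  by move=> /MF tF cE; apply: thicken_mem => //; rewrite inE cE orbT.
have := entropy_bound fin_quot hP hnuS hnuY hnuP midx midx' idx'W FWA MEA M_disj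
  eta_le d0 d1.
rewrite -/g; set u := fine (nu _) in cost *.
set cst := _ - u * _ in cost *.
set m := (size M)%:R; set N := (size (spread E))%:R.
have N0 : 0 < N :> R by rewrite ltr0n.
set f := #|` F n|%:R in Fn0 card_A *; set a := #|` A|%:R in card_A *.
have fmN : f <= m * N by rewrite /f /m /N -natrM ler_nat.
move=> le_H.
apply: (@le_trans _ _ ((f^-1)%:E * (a * D - m * g + f * cst)%:E)%E).
  by apply: lee_wpmul2l => //; rewrite lee_fin invr_ge0 ltW.
rewrite -EFinM lee_fin mulrC ler_pdivrMr//.
have H1 : a * D <= f * D + f * (e / 2).
  move: eD0 card_A; set x := e / 2 / (D + 1) => x0 card_A.
  have xD : x * D <= e / 2.
    have -> : e / 2 = x * (D + 1) by rewrite /x divfK ?gt_eqF.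
    by rewrite ler_pM2l// lerDl.
  apply: (@le_trans _ _ ((1 + x) * f * D)).
    by rewrite ler_wpM2r// density_ge0.
  have -> : (1 + x) * f * D = f * D + f * (x * D) by ring.
  by rewrite lerD2l ler_pM2l.
have H2 : f * (g / N) <= m * g.
  by rewrite mulrA ler_pdivrMr// mulrAC ler_wpM2r.
have H3 : f * cst <= f * (e / 2) by rewrite ler_pM2l.
lra.
Qed.

(** The saving is the same for every partition, so it passes to the supremum. *)
Lemma relative_entropy_le (E : {fset OK K}) (eta : R) :
  let g := (eta * bias P nu E - 2 * eta ^+ 2) / ln 2 in
  `|eta| <= 2^-1 -> 0 <= g ->
  (relative_entropy (@shift_map K) nu F (F_theta b) <=
   (D - g / (size (spread E))%:R)%:E)%E.
Proof.
move=> g eta_le g0; apply: ge_ereal_sup => _ [k [Q [[Qcov Qtriv _] mQ ->]]].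
have /choice[idx idxP] : forall x, exists i, Q i x.
  move=> x; have : cover setT Q x by rewrite Qcov.
  by move=> [i _ Qix]; exists i.
have QE : Q = fun i => idx @^-1` [set i].
  apply/funext => i; apply/seteqP; split => x /=; last by move=> <-.
  by move=> Qix; apply: (Qtriv (idx x) i) => //; exists x.
have midx i : measurable (idx @^-1` [set i]) by have := mQ i; rewrite QE.
rewrite /entropy_partition QE; set u := fun n => _.
have u_le e : 0 < e ->
    \forall n \near \oo, (u n <= (D - g / (size (spread E))%:R + e)%:E)%E.
  exact: entropy_partition_near.
have u_ge0 n : (0 <= u n)%E.
  rewrite mule_ge0 ?lee_fin ?invr_ge0//.
  apply: cond_entropy_ge0; first exact: sigma_algebra_F_theta.
    exact: F_theta_measurable.
  exact: measurable_join_partition.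
apply/lee_addgt0Pr => e e0; rewrite -EFinD.
have [cu|ncu] := pselect (cvgn u); first by apply: lime_le => //; exact: u_le.
(* [limn] of a divergent sequence is [0]. *)
rewrite (dvgP ncu).
have [n _ /(_ n (leqnn n))] := u_le e e0.
exact: le_trans (u_ge0 n).
Qed.

End UpperBound.

(** * The measure kappa *)

Section Kappa.
Variables (K : fieldExtType rat) (b : nat -> idealr (OK K)) (R : realType).
Hypothesis fin_quot : forall l, finite_set [set: {ideal_quot (b l)}].
Variables (P : probability (borel (phase_group b)) R) (hP : is_haar P).
Variables (beta : probability (borel (config K)) R) (hbeta : fair_coin beta).
Variables (nu : probability (borel (config K)) R).
Implicit Types (E : {fset OK K}) (x : borel (config K)).
Local Notation varphi := (@varphi K b).

Lemma kappaM (B : set (borel (phase_group b))) (A C : set (borel (config K))) :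
  measurable B -> measurable C -> @Phi K b @^-1` A = B `*` C ->
  kappa P beta A = (P B * beta C)%E.
Proof. by move=> mB mC AE; rewrite /kappa /pushforward AE product_measure1E. Qed.

Lemma kappa_covers E :
  kappa P beta (covers E) = (P (varphi @^-1` covers E) * (2^-1 ^+ #|` E|)%:E)%E.
Proof.
rewrite -(hbeta E (fun=> true)); apply: kappaM.
- by apply: measurable_preimageT; [exact: measurable_varphi|exact: measurable_covers].
- exact: measurable_covers.
- apply/seteqP; split => -[g w] /= H.
    by split=> e /H; rewrite /Phi /= => /andP[].
  by move=> c cE; rewrite /Phi /=; apply/andP; split; [exact: H.1|exact: H.2].
Qed.

Lemma bias_eq0 E : bias P nu E = 0 <-> nu (covers E) = kappa P beta (covers E).
Proof.
have mE := measurable_covers E.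
have mE' : measurable (varphi @^-1` covers E).
  by apply: measurable_preimageT => //; exact: measurable_varphi.
rewrite kappa_covers /bias -(fineK (fin_num_measure nu _ mE)).
rewrite -[P _]fineK ?fin_num_measure// -EFinM /=.
split=> [/eqP|[->]]; first by rewrite subr_eq0 mulrC => /eqP ->.
by rewrite mulrC subrr.
Qed.

Let G : set (set (borel (config K))) := range (@covers K).

Lemma eq_kappa : (forall E, bias P nu E = 0) ->
  forall A, measurable A -> nu A = kappa P beta A.
Proof.
move=> b0 A mA.
have GI : setI_closed G.
  move=> _ _ [E _ <-] [E' _ <-]; exists (E `|` E')%fset => //.
  apply/seteqP; split=> x /=.
    by move=> xE; split => e eE; apply: xE; rewrite inE eE ?orbT.
  by move=> [xE xE'] c; rewrite inE => /orP[/xE|/xE'].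
have openG : @open (config K) `<=` <<s G >>.
  move=> U oU.
  apply: (@measurable_preimage_open _ _ _ (@OK_code_inj K) _
    (g_sigma_algebraType G) id) oU => [a c|a]; last exact: countableP.
  have ma : measurable ([set x | x a] : set (g_sigma_algebraType G)).
    apply: sub_sigma_algebra; exists [fset a]%fset => //.
    apply/seteqP; split => x /= H; first by apply: H; rewrite inE.
    by move=> e /fset1P ->.
  case: c; first exact: ma.
  rewrite (_ : [set t | _] = ~` [set x : borel (config K) | x a]).
    exact: (@measurableC _ (g_sigma_algebraType G)).
  by apply/seteqP; split => x /=; [move=> -> | case: (x a)].
have mG : @measurable _ (borel (config K)) = <<s G >>.
  apply/seteqP; split.
    by apply: smallest_sub => //; exact: smallest_sigma_algebra.
  apply: smallest_sub; first exact: sigma_algebra_measurable.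
  by move=> _ [E _ <-]; exact: measurable_covers.
apply: (measure_unique G (fun=> setT) mG GI _ _ nu
  (pushforward (P \x beta)%E (@Phi K b))) => //.
- by move=> i; exists fset0 => //; apply/seteqP; split => // x _ c; rewrite inE.
- by rewrite bigcup_const//; exists 0%N.
- exact: measurable_Phi.
- by move=> ? _ [E _ <-]; apply/bias_eq0.
- by move=> _; rewrite ltey_eq fin_num_measure.
Qed.

End Kappa.

Section KappaEntropy.
Variables (K : fieldExtType rat) (b : nat -> idealr (OK K)) (R : realType).
Hypothesis fin_quot : forall l, finite_set [set: {ideal_quot (b l)}].
Variables (P : probability (borel (phase_group b)) R) (hP : is_haar P).
Variables (beta : probability (borel (config K)) R) (hbeta : fair_coin beta).
Variables (nu : probability (borel (config K)) R).
Hypotheses (hnuY : nu (Y b) = 1%E)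
  (hnuP : forall A, measurable A -> pushforward nu (@theta K b) A = P A)
  (hk : forall A, measurable A -> nu A = kappa P beta A).
Implicit Types (A : {fset OK K}) (x : borel (config K)).
Local Notation varphi := (@varphi K b).

Lemma measurable_restr A (w : {ffun A -> bool}) :
  measurable (restr A @^-1` [set w]).
Proof.
rewrite (_ : _ @^-1` _ = [set x | forall a : A, x (val a) = w a]).
  apply: measurable_forall => [|a]; first exact: countableP.
  case: (w a); first exact: measurable_config_coord.
  rewrite (_ : [set x | _] = [set x : borel (config K) | ~ x (val a)]).
    by apply: measurable_not; exact: measurable_config_coord.
  by apply/seteqP; split => x /=; [move=> ->|move=> /negP/negbTE].
apply/seteqP; split => x /=.
  by move=> <- a; rewrite ffunE.
by move=> xw; apply/ffunP => a; rewrite ffunE; exact: xw.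
Qed.

(** For a fixed phase only the coins at the allowed sites, collected in [E], influence the window; a
    word with a 1 at a forbidden site is impossible. *)
Lemma fair_coin_restr A (g : borel (phase_group b)) (w : {ffun A -> bool}) :
  beta [set x | restr A (Phi (g, x)) = w] =
  (coin_weight (restr A (varphi g)) w)%:E.
Proof.
have [ws|] := pselect (forall a, w a -> restr A (varphi g) a); last first.
  move=> /existsNP[a /not_implyP[wa sa]].
  rewrite (coin_weight_eq0 wa); last exact/negP.
  rewrite (_ : [set x | _] = set0) ?measure0//.
  apply/seteqP; split => x //= xw; apply: sa.
  by move: wa; rewrite -xw !ffunE => /andP[].
pose E : {fset OK K} := [fset a in A | varphi g a]%fset.
have -> : [set x | restr A (Phi (g, x)) = w] =
    [set x | forall a, a \in E -> x a = extend w a].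
  apply/seteqP; split => x /=.
    move=> <- a; rewrite !inE => /andP[aA ga].
    by rewrite extend_restr// /Phi /= ga.
  move=> xE; apply/ffunP => a; rewrite ffunE /Phi /=.
  have := ws a; rewrite ffunE; case: (boolP (varphi g (val a))) => [ga _|_ wa] /=.
    rewrite xE; last by rewrite !inE ga fsvalP.
    by rewrite /extend valK.
  by case: (w a) wa => // /(_ isT).
rewrite hbeta coin_weightE//; congr ((2^-1 ^+ _)%:E).
rewrite card_fset_sum1 /E -big_fset_condE/= big_seq_fsetE/= -sum1_card.
by apply: eq_bigl => a; rewrite inE ffunE.
Qed.

(** Off the set where [Phi (g, x)] leaves [Y], its phase is [g], so the event lies over [C] and the
    product measure integrates [fair_coin_restr] there. This set is null because [hk] transfers
    [nu (Y b) = 1] to [kappa]. *)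
Lemma kappa_is_cond_prob A (w : {ffun A -> bool}) :
  is_cond_prob nu (F_theta b) (restr A @^-1` [set w])
    (fun x => coin_weight (restr A (phi b x)) w).
Proof.
have mcell := @measurable_restr A.
have sF := sigma_algebra_F_theta b.
have Fs := @F_theta_restr K b A.
split.
- apply: (@measurable_fun_fintype _ (g_sigma_algebraType (F_theta b)) R _
    (fun x => restr A (phi b x)) (fun s => coin_weight s w)) => s.
  exact/(measurable_subsigma _ sF).
- apply: (@integrable_fintype _ _ R nu _ (fun x => restr A (phi b x))
    (fun s => coin_weight s w)) => s.
  exact: (F_theta_measurable fin_quot (Fs s)).
move=> _ [C mC <-]; rewrite setTI.
have mtheta := measurable_theta fin_quot.
have mthC : measurable (theta b @^-1` C) by exact: measurable_preimageT.
have mPhi := @measurable_Phi K b.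
pose S : set (borel (phase_group b) * borel (config K)) :=
  [set t | restr A (Phi t) = w /\ C t.1].
have mS : measurable S.
  apply: measurableI.
    exact: (measurable_preimageT mPhi (mcell w)).
  exact: (measurable_preimageT measurable_fst mC).
have mYc : measurable (~` Y b) by apply: measurableC; exact: measurable_Y.
have Yc0 : (P \x beta)%E (@Phi K b @^-1` (~` Y b)) = 0%E.
  rewrite -[LHS]/(kappa P beta (~` Y b)) -hk//.
  by rewrite probability_setC ?hnuY ?subee//; exact: measurable_Y.
have -> : nu (restr A @^-1` [set w] `&` theta b @^-1` C) = (P \x beta)%E S.
  rewrite hk; last exact: measurableI.
  apply: (measure_eq_off_null (N := @Phi K b @^-1` (~` Y b))) => //.
  - by apply: (measurable_preimageT mPhi); exact: measurableI.
  - exact: measurable_preimageT.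
  - move=> [g x] /= /contrapT Yx.
    by rewrite /S /preimage/= (theta_Phi fin_quot Yx).
rewrite /product_measure1.
have mweight : measurable_fun setT
    (fun g : borel (phase_group b) => (coin_weight (R := R) (restr A (varphi g)) w)%:E).
  apply/measurable_EFinP.
  apply: (@measurable_fun_fintype _ _ R _ (fun g => restr A (varphi g))
    (fun s => coin_weight s w)) => s.
  exact: measurable_restr_varphi.
transitivity (\int[P]_(g in C) (coin_weight (restr A (varphi g)) w)%:E)%E.
  rewrite -(@eq_measure_integral _ _ _ C P (pushforward nu (theta b))); last first.
    by move=> B mB _; exact: hnuP.
  rewrite ge0_integral_pushforward//; first exact: measurable_funTS.
  by move=> g _; rewrite lee_fin coin_weight_ge0.
rewrite integral_mkcond; apply: eq_integral => g _.
rewrite patchE /=; case: ifPn => gC.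
  rewrite -fair_coin_restr; congr (beta _); apply/seteqP; split => x /=.
    by move=> xw; rewrite /xsection /= inE; split => //; exact: set_mem.
  by rewrite /xsection /= inE => -[].
rewrite (_ : xsection S g = set0) ?measure0//; apply/seteqP; split => x //=.
by rewrite /xsection /= inE => -[_ /mem_set]; rewrite (negbTE gC).
Qed.

(** Given the phase the window is uniform on the words over allowed sites, so the entropy is the
    mean number of such sites: exact for every finite [A], with no error term. *)
Lemma kappa_entropy A : let idx x : 'I_2 := if x 0 then ord_max else ord0 in
  cond_entropy nu (F_theta b)
    (@join_partition _ _ _ (@shift_map K) A _ (fun i => idx @^-1` [set i])) =
  (#|` A|%:R * density b R)%:E.
Proof.
move=> idx.
(* Partitions are indexed by ordinals, windows by booleans; these two maps translate between
   them. *)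
pose name (c : {ffun A -> 'I_2}) : {ffun A -> bool} := [ffun a => c a == ord_max].
pose unname (w : {ffun A -> bool}) : {ffun A -> 'I_2} :=
  [ffun a => if w a then ord_max else ord0].
have nameK : cancel name unname.
  move=> c; apply/ffunP => a; rewrite !ffunE; case: eqP => [->//|].
  by case: (c a) => -[|[|[]]]// i H; [exact/val_inj|case: H; exact/val_inj].
have unnameK : cancel unname name.
  by move=> w; apply/ffunP => a; rewrite !ffunE; case: (w a).
have S0 (a : OK K) : a + 0 = a by exact: addr0.
have joinE : @join_partition _ _ _ (@shift_map K) A _ (fun i => idx @^-1` [set i]) =
    (fun c => restr A @^-1` [set name c]).
  apply/funext => c; apply/seteqP; split => x /=.
    move=> xc; apply/ffunP => a; rewrite !ffunE -(xc a) /idx /shift_map S0.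
    by case: (x _).
  move=> xc a; rewrite /= -(nameK c) -xc !ffunE /idx /shift_map S0.
  by case: (x _).
have sF := sigma_algebra_F_theta b.
have mF := F_theta_measurable fin_quot.
rewrite joinE (@cond_entropy_is_cond_prob _ _ _ _ _ sF mF _ _
  (fun c x => coin_weight (restr A (phi b x)) (name c))); last 2 first.
- by move=> c; exact: measurable_restr.
- by move=> c; exact: kappa_is_cond_prob.
pose r : seq (R * set (borel (config K))) := [seq (1, [set x | phi b x a]) | a <- A].
have mr p : p \in r -> measurable p.2.
  move=> /mapP[a _ ->]; apply: (@measurable_preimageT _ _ _ _ (phi b) [set x | x a]).
    exact: measurable_phi.
  exact: measurable_config_coord.
have [_ Ir] := integral_simple_comb nu mr.
transitivity (\int[nu]_x (simple_comb r x)%:E)%E.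
  apply: eq_integral => x _; congr (_%:E).
  rewrite (reindex unname)/=; last by exists name => ? _; [exact: unnameK|exact: nameK].
  under eq_bigr do rewrite unnameK.
  rewrite entropy_coin_weight /simple_comb big_map big_seq_fsetE/= -sum1_card.
  rewrite natr_sum big_mkcond/=; apply: eq_bigr => a _; rewrite mul1r indicE inE ffunE.
  by case: ifPn => px; [rewrite mem_set|rewrite memNset//; exact/negP].
rewrite Ir big_map; congr (_%:E) => /=.
under eq_bigr do rewrite (nu_phi_coord fin_quot hP hnuP) mul1r.
by rewrite big_const_seq count_predT iter_addr addr0 mulr_natl.
Qed.

End KappaEntropy.

(* An infinite quotient would have [ideal_norm] 0, because [fset_set] sends
   infinite sets to [fset0]. *)
Lemma XB_finite_quot (K : fieldExtType rat) (b : nat -> idealr (OK K))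
    (x : borel (config K)) : XB b x ->
  forall l, finite_set [set: {ideal_quot (b l)}].
Proof.
move=> xX l; apply: contrapT => infQ; have := xX l.
suff -> : ideal_norm (b l) = 0%N by [].
by rewrite /ideal_norm /fset_set; case: pselect => // finQ; rewrite cardfs0.
Qed.

Lemma normr_subM_le1 (R : realType) (u c v : R) :
  0 <= u <= 1 -> 0 <= c <= 1 -> 0 <= v <= 1 -> `|u - c * v| <= 1.
Proof.
move=> /andP[u0 u1] /andP[c0 c1] /andP[v0 v1].
have cv0 : 0 <= c * v by exact: mulr_ge0.
have cv1 : c * v <= 1 by rewrite -[leRHS]mulr1 ler_pM.
by rewrite ler_norml; apply/andP; split; lra.
Qed.

(** [B / 4] maximises [eta * B - 2 * eta ^+ 2] over [eta]; the maximum is [B ^+ 2 / 8]. *)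
Lemma quarter_gain (R : realType) (B : R) : `|B| <= 1 -> B != 0 ->
  `|B / 4| <= 2^-1 /\ 0 < (B / 4 * B - 2 * (B / 4) ^+ 2) / ln 2.
Proof.
move=> B1 B0; split.
  by rewrite normrM (@ger0_norm _ 4^-1) ?invr_ge0//; lra.
have -> : B / 4 * B - 2 * (B / 4) ^+ 2 = B ^+ 2 / 8 by field.
by rewrite !divr_gt0 ?ln2_gt0// exprn_even_gt0.
Qed.

(** * Comparison of the entropy with the density *)

Section Comparison.
Variables (K : fieldExtType rat) (b : nat -> idealr (OK K)) (R : realType).
Hypothesis fin_quot : forall l, finite_set [set: {ideal_quot (b l)}].
Variables (P : probability (borel (phase_group b)) R) (hP : is_haar P).
Variables (beta : probability (borel (config K)) R) (hbeta : fair_coin beta).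
Variables (nu : probability (borel (config K)) R).
Hypotheses (hnuS : shift_invariant nu) (hnuY : nu (Y b) = 1%E)
  (hnuP : forall A, measurable A -> pushforward nu (@theta K b) A = P A).
Variables (F : nat -> {fset OK K}) (hF : folner R F).
Local Notation h := (relative_entropy (@shift_map K) nu F (F_theta b)).
Local Notation D := (density b R).

(** The untilted case [eta = 0], where the saving vanishes. *)
Lemma relative_entropy_le_density : (h <= D%:E)%E.
Proof.
have := @relative_entropy_le K b R fin_quot P hP nu hnuS hnuY hnuP F hF fset0 0.
rewrite /= mul0r expr0n/= mulr0 subr0 !mul0r subr0 normr0; exact.
Qed.

Lemma bias_le1 E : `|bias P nu E| <= 1.
Proof.
have mE := measurable_covers E.
have mE' : measurable (varphi (b := b) @^-1` covers E).
  by apply: measurable_preimageT => //; exact: measurable_varphi.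
have f01 d (T : measurableType d) (m : probability T R) (A : set T) :
    measurable A -> 0 <= fine (m A) <= 1.
  by move=> mA; rewrite -!lee_fin fineK ?fin_num_measure// measure_ge0 probability_le1.
rewrite /bias; apply: normr_subM_le1; [exact: f01| |exact: f01].
by rewrite exprn_ge0 ?invr_ge0//= exprn_ile1 ?invr_ge0// invf_le1// ler1n.
Qed.

Lemma relative_entropy_lt_density E : bias P nu E != 0 -> (h < D%:E)%E.
Proof.
have := @relative_entropy_le K b R fin_quot P hP nu hnuS hnuY hnuP F hF E.
move: (bias_le1 E); move: (bias P nu E) => B B1 le_h B0.
have [B4 g0] := quarter_gain B1 B0.
apply: le_lt_trans (le_h _ B4 (ltW g0)) _.
by rewrite lte_fin gtrBl divr_gt0// ltr0n.
Qed.

Lemma relative_entropy_kappa : (forall A, measurable A -> nu A = kappa P beta A) ->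
  (D%:E <= h)%E.
Proof.
move=> hk; pose idx (x : borel (config K)) : 'I_2 := if x 0 then ord_max else ord0.
have midx i : measurable (idx @^-1` [set i]).
  rewrite (_ : _ @^-1` _ = [set x : borel (config K) |
      (x 0 -> i = ord_max) /\ (~ x 0 -> i = ord0)]).
    have m0 := @measurable_config_coord K 0.
    apply: measurable_conj; apply: measurable_imply => //;
      [exact: measurable_constP|exact: measurable_not|exact: measurable_constP].
  apply/seteqP; split => x /=; rewrite /idx; case: (x 0) => /=.
  + by move=> <-; split.
  + by move=> <-; split.
  + by move=> [/(_ isT)].
  + by move=> [_ /(_ notF)].
apply: ereal_sup_ubound; exists 2%N, (fun i => idx @^-1` [set i]); split.
- split.
  + by apply/seteqP; split => // x _; exists (idx x).
  + by move=> i j _ _ [x [/= <- <-]].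
  + move=> i _; exists (fun=> i == ord_max); rewrite /idx /=.
    case: eqP => [->//|]; case: i => -[|[|[]]]// i H; first exact/val_inj.
    by case: H; exact/val_inj.
- exact: midx.
- rewrite /entropy_partition.
  rewrite (_ : (fun n => _) = fun=> D%:E); first by rewrite lim_cst.
  apply/funext => n; rewrite (kappa_entropy fin_quot hP hbeta hnuY hnuP hk).
  rewrite -EFinM mulrA mulVf ?mul1r//.
  by rewrite gt_eqF// folner_card_gt0.
Qed.

End Comparison.

Theorem proposition3p4 (R : realType) (K : fieldExtType rat)
    (b : nat -> idealr (OK K)) (hb : erdos_family R b)
    (F : nat -> {fset OK K}) (hF : folner R F) (hFt : tempered F)
    (P : probability (borel (phase_group b)) R) (hP : is_haar P)
    (beta : probability (borel (config K)) R) (hbeta : fair_coin beta)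
    (nu : probability (borel (config K)) R)
    (hnuX : nu (XB b) = 1%E) (hnuS : shift_invariant nu)
    (hnuY : nu (Y b) = 1%E)
    (hnuP : forall A, measurable A -> pushforward nu (@theta K b) A = P A) :
  (relative_entropy (@shift_map K) nu F (F_theta b) <= (density b R)%:E)%E /\
  (relative_entropy (@shift_map K) nu F (F_theta b) = (density b R)%:E <->
   forall A, measurable A -> nu A = kappa P beta A).
Proof.
(* Since [XB b] has measure 1 it contains a configuration, whose existence excludes an infinite
   quotient. *)
have fin_quot : forall l, finite_set [set: {ideal_quot (b l)}].
  have [XB0|/set0P[x]] := eqVneq (XB b) set0; last exact: XB_finite_quot.
  by move: hnuX; rewrite XB0 measure0 => /esym/eqP; rewrite onee_eq0.
have le_D := relative_entropy_le_density fin_quot hP hnuS hnuY hnuP hF.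
split=> //; split=> [hD|hk].
  apply: eq_kappa => // E; apply/eqP; apply: contraTT isT => b0.
  have := relative_entropy_lt_density fin_quot hP hnuS hnuY hnuP hF b0.
  by rewrite hD ltxx.
apply: le_anti; rewrite le_D.
exact: (@relative_entropy_kappa K b R fin_quot P hP beta hbeta nu hnuY hnuP F hF hk).
Qed.
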